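(* There is a deterministic online algorithm that outputs a fractional solution for the $k$-server problem when the metric $(X,d)$ is a tree metric, with competitive ratio $O(D \log k)$, where $D$ is the hop-diameter of the tree.
   Context: The $k$-server problem: given a metric space $(X,d)$ with $n=|X|$ points, requests $r_1,r_2,\ldots$ (points of $X$) arrive online; an (integral) algorithm maintains a set $A_t\subseteq X$ of $k$ server locations with $r_t\in A_t$ for all $t$, and pays the total (earthmover) distance moved by the servers between consecutive configurations. A tree metric is the shortest-path metric of a tree with nonnegative edge lengths; its hop-diameter is the maximum number of edges on a simple path in the tree. A fractional solution maintains at each time $t$ a vector of nonnegative server masses on the points, with mass $1$ at the requested point $r_t$ (in the paper's fractional solutions the total mass is $k+\tfrac12$), and its cost is the sum over time of the earthmover distances (in the tree metric) between consecutive mass vectors. Competitive ratio $\alpha$ means that for every request sequence the algorithm's cost is at most $\alpha$ times the cost of an optimal (integral, offline) $k$-server solution plus an additive term independent of the request sequence. *)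

(* Defs.v *)
From HB Require Import structures.
From mathcomp Require Import all_boot all_order all_algebra.
From mathcomp Require Import boolp classical_sets reals exp.
Set Implicit Arguments.
Unset Strict Implicit.
Unset Printing Implicit Defensive.
Import Order.TTheory GRing.Theory Num.Theory.
Local Open Scope ring_scope.
Local Open Scope classical_set_scope.

(** * Trees with edge lengths *)

Definition simple_graph (X : finType) (e : rel X) : Prop :=
  symmetric e /\ irreflexive e.

(* A [ucycle] of size 2 goes back and forth along one edge, so only the sizes
   at least 3 are cycles in the sense of graph theory. *)
Definition acyclic (X : finType) (e : rel X) : Prop :=
  forall c : seq X, ucycle e c -> (size c <= 2)%N.

Definition is_tree (X : finType) (e : rel X) : Prop :=
  [/\ simple_graph e, forall x y : X, connect e x y & acyclic e].

(* The values of [len] outside the edges of [e] are irrelevant. *)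
Definition edge_lengths (R : realType) (X : finType) (e : rel X)
    (len : X -> X -> R) : Prop :=
  forall x y : X, e x y -> 0 <= len x y /\ len x y = len y x.

(* Length of the walk [x :: p]. *)
Fixpoint walk_length (R : realType) (X : finType) (len : X -> X -> R)
    (x : X) (p : seq X) : R :=
  if p is y :: q then len x y + walk_length len y q else 0.

(* Shortest-path distance; zero-length edges make it a pseudometric. *)
Definition path_dist (R : realType) (X : finType) (e : rel X)
    (len : X -> X -> R) (x y : X) : R :=
  inf [set c : R | exists p : seq X,
         [/\ path e x p, last x p = y & c = walk_length len x p]].

(* Maximum number of edges on a simple path; a simple path has fewer than
   [#|X|] edges, which makes the range of the maximum finite. *)
Definition hop_diameter (X : finType) (e : rel X) : nat :=
  \max_(m < #|X| | [exists x : X, [exists p : m.-tuple X,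
                      path e x p && uniq (x :: p)]]) m.

(** * Earthmover distance and movement cost *)

Definition transport_plan (R : realType) (X : finType) (u v : X -> R)
    (f : X -> X -> R) : Prop :=
  [/\ forall x y : X, 0 <= f x y,
      forall x : X, \sum_(y : X) f x y = u x
    & forall y : X, \sum_(x : X) f x y = v y].

(* Meaningful for nonnegative [u] and [v] of equal total mass, the only case in
   which it is used below. *)
Definition earthmover (R : realType) (X : finType) (d : X -> X -> R)
    (u v : X -> R) : R :=
  inf [set c : R | exists f : X -> X -> R,
         transport_plan u v f /\
         c = \sum_(x : X) \sum_(y : X) f x y * d x y].

Definition movement_cost (R : realType) (X : finType) (d : X -> X -> R)
    (T : nat) (u : nat -> X -> R) : R :=
  \sum_(t < T) earthmover d (u t) (u t.+1).

(** * Integral offline solutions *)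

Definition set_mass (R : realType) (X : finType) (A : {set X}) : X -> R :=
  fun x => (x \in A)%:R.

(* [A 0] is the initial configuration, chosen freely by the offline solution;
   [A t] serves the [t]-th request, which is [tnth (in_tuple r) i] for
   [t = i.+1]. *)
Definition offline_solution (X : finType) (k : nat) (r : seq X)
    (A : nat -> {set X}) : Prop :=
  (forall t : nat, #|A t| = k) /\
  (forall i : 'I_(size r), tnth (in_tuple r) i \in A i.+1).

Definition opt_cost (R : realType) (X : finType) (d : X -> X -> R) (k : nat)
    (r : seq X) : R :=
  inf [set c : R | exists A : nat -> {set X},
         offline_solution k r A /\
         c = movement_cost d (size r) (fun t => set_mass R (A t))].

(** * Deterministic online fractional algorithms *)

(* [alg s] is the mass vector held after the requests [s], listed in order of
   arrival: being a function of the past requests is what makes the algorithm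
   deterministic and online. [alg [::]] is its initial vector. *)
Definition online_fractional (R : realType) (X : finType) (k : nat)
    (alg : seq X -> X -> R) : Prop :=
  [/\ forall (s : seq X) (x : X), 0 <= alg s x,
      forall s : seq X, \sum_(x : X) alg s x = k%:R + 2^-1
    & forall (s : seq X) (x : X), alg (rcons s x) x = 1].

Definition online_cost (R : realType) (X : finType) (d : X -> X -> R)
    (alg : seq X -> X -> R) (r : seq X) : R :=
  movement_cost d (size r) (fun t => alg (take t r)).

Definition competitive (R : realType) (X : finType) (d : X -> X -> R) (k : nat)
    (alg : seq X -> X -> R) (alpha : R) : Prop :=
  exists c : R, forall r : seq X,
    online_cost d alg r <= alpha * opt_cost d k r + c.

(* Main.v *)
Require Import Defs.
From HB Require Import structures.
From mathcomp Require Import all_boot all_order all_algebra.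
From mathcomp Require Import boolp classical_sets reals exp.
From mathcomp Require Import topology normedtype sequences derive ring lra zify.
Set Implicit Arguments.
Unset Strict Implicit.
Unset Printing Implicit Defensive.
Import Order.TTheory GRing.Theory Num.Theory.
Import numFieldNormedType.Exports.
Local Open Scope ring_scope.

(** The algorithm is an entropic Bregman projection, run on anti-mass profiles.
    For every vertex [v] and every [j], a variable records how much is missing
    for [v]'s subtree to hold more than [j] servers; each request is served by
    projecting, with weights equal to the edge lengths, onto the profiles which
    are consistent along the tree and nearly occupy the requested point.  The
    multipliers of the projection say where mass enters and leaves each vertex.
    Up to telescoping terms the flow out of a level is the flow into the next
    one, so the movement is at most about [D] times the contribution [M] of the
    lower-bound constraints; and [M] is paid for by the decrease of the relative
    entropy of the offline profile, mixed with a floor [delta ~ 1 / k], with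
    respect to the online one.  An offline move costs at most [ln (1 / delta)]
    times its length in this potential, which gives [O(D log k)]. *)

(** * Entropic projections *)

(** Slots, rather than one mass per subtree, are what produces the logarithm: a server crossing an
    edge flips a single slot there, so its effect on the potential is bounded by the edge length
    times [ln (1 / delta)], whatever the size of the subtree. The price is that slots must stay
    ordered, stay below 1 and agree with the masses below them. None of this is imposed on the
    projection beyond one-sided inequalities, since each further constraint would bring a
    multiplier, possibly of the wrong sign, that the cost bound would have to pay for. Order, the
    bound 1 and exact conservation of mass are instead deduced from the optimality conditions and
    carried along as the invariant [admissible]. The other obstacle is the request: its multiplier
    works against the potential. The surplus of half a server leaves a gap between the online
    capacity [2 * delta] and the offline value [delta] at the requested point, and this gap absorbs
    the loss. *)

Lemma expR_le_quadratic (R : realType) (z : R) : `|z| <= 2^-1 -> expR z <= 1 + z + 2 * z ^+ 2.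
Proof.
rewrite ler_norml => /andP[z1 z2].
have h := expR_ge1Dx (- z).
rewrite expRN in h.
have e0 := expR_gt0 z.
have h2 : (1 - z) * expR z <= 1.
  by rewrite -ler_pdivlMr// div1r.
have h3 : 1 <= (1 + z + 2 * z ^+ 2) * (1 - z).
  by have : 0 <= z^+2 * (1 - 2 * z) by [apply: mulr_ge0; [exact: sqr_ge0|lra]]; nra.
have h4 : 0 < 1 - z by lra.
rewrite -(ler_pM2r h4); lra.
Qed.

(** Replaces differentiation: a one-sided first-order condition is read off from a quadratic
    remainder. *)
Lemma le0_of_quadratic (R : realType) (c K h0 : R) : 0 < h0 -> 0 <= K ->
  (forall h, 0 < h -> h <= h0 -> h * c <= h ^+ 2 * K) -> c <= 0.
Proof.
move=> h00 K0 H; rewrite leNgt; apply/negP => c0.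
set h := Num.min h0 (c / (2 * (K + 1))).
have K1 : 0 < 2 * (K + 1) by lra.
have hh : 0 < h by rewrite lt_min h00 divr_gt0.
have := H h hh; rewrite ge_min lexx => /(_ isT).
rewrite expr2 -mulrA ler_pM2l// => ch.
have : h * K <= c / (2 * (K+1)) * K by rewrite ler_wpM2r// ge_min lexx orbT.
have : c / (2 * (K + 1)) * (2 * (K+1)) = c by rewrite divfK// gt_eqF.
have : 0 < c / (2 * (K + 1)) by rewrite divr_gt0.
set q := c / _; nra.
Qed.

Section entropic_kkt.
Variables (R : realType) (E J : finType) (a : J -> E -> R) (b : J -> R).
Variables (w x y : E -> R).
Hypotheses (w0 : forall e, 0 < w e) (x0 : forall e, 0 < x e).
Hypotheses (y0 : forall e, 0 < y e).
Hypothesis slater : forall j, b j < \sum_e a j e * y e.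

Let tilt (l : J -> R) e := \sum_j l j * a j e.
Let upd (l : J -> R) e := x e * expR (tilt l e / w e).
(** Lagrangian dual of minimizing [\sum_e w e * (z e * ln (z e / x e) - z e + x e)] under the
    constraints [b j <= \sum_e a j e * z e], without the constant [\sum_e w e * x e]; [upd l]
    minimizes the Lagrangian. *)
Let dual (l : J -> R) := \sum_j l j * b j - \sum_e w e * upd l e.

Let bnd := - \sum_e w e * y e * (1 + ln (x e / y e)).

(** Weak duality at the Slater point, from [1 + s <= expR s] with [s = tilt / w + ln (x / y)].
    Keeping the slack of [y] makes the bound fall linearly in every multiplier, so that the search
    for a maximizer can be confined to a compact box. *)
Let dual_le l : dual l <= bnd - \sum_j l j * (\sum_e a j e * y e - b j).
Proof.
have H e : tilt l e * y e + w e * y e * (1 + ln (x e / y e)) <= w e * upd l e.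
  have := expR_ge1Dx (tilt l e / w e + ln (x e / y e)).
  rewrite expRD lnK ?posrE ?divr_gt0// => h.
  have wy : 0 < w e * y e by rewrite mulr_gt0.
  rewrite -(ler_pM2l wy) in h.
  apply: le_trans (le_trans h _); last first.
    rewrite /upd le_eqVlt; apply/orP; left; apply/eqP.
    by field; rewrite gt_eqF.
  rewrite le_eqVlt; apply/orP; left; apply/eqP.
  by field; rewrite gt_eqF.
have : \sum_e (tilt l e * y e + w e * y e * (1 + ln (x e / y e)))
   <= \sum_e w e * upd l e by apply: ler_sum.
rewrite big_split /=.
have -> : \sum_e tilt l e * y e = \sum_j l j * (\sum_e a j e * y e).
  under eq_bigr do rewrite mulr_suml.
  rewrite exchange_big /=; apply: eq_bigr => j _.
  by rewrite mulr_sumr; apply: eq_bigr => e _; rewrite mulrA.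
rewrite /dual /bnd.
under [X in _ -> _ <= _ - X]eq_bigr do rewrite mulrBr.
rewrite sumrB; lra.
Qed.

Let gap j := \sum_e a j e * y e - b j.
Let gap0 j : 0 < gap j. Proof. by rewrite /gap subr_gt0. Qed.
Let dual0 := dual (fun=> 0).
Let d0le : 0 <= bnd - dual0.
Proof.
have := dual_le (fun=> 0).
by rewrite [X in _ <= _ - X]big1 ?subr0 ?subr_ge0// => j _; rewrite mul0r.
Qed.
Let B := \sum_j (bnd - dual0) / gap j.
Let B0 : 0 <= B.
Proof. by apply: sumr_ge0 => j _; rewrite divr_ge0// ltW. Qed.

Let outside l j : (forall i, 0 <= l i) -> B < l j -> dual l < dual0.
Proof.
move=> l0 Bl; apply: le_lt_trans (dual_le l) _.
rewrite ltrBlDr -ltrBlDl.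
apply: (@lt_le_trans _ _ (l j * gap j)); last first.
  rewrite (bigD1 j)//= lerDl; apply: sumr_ge0 => i _.
  by rewrite mulr_ge0// ltW// gap0.
rewrite -ltr_pdivrMr//; apply: le_lt_trans Bl.
rewrite /B (bigD1 j)//= lerDl; apply: sumr_ge0 => i _.
by rewrite divr_ge0// ltW.
Qed.

Let vec (v : 'rV[R]_#|J|) j := v ord0 (enum_rank j).

Let dual_cont : continuous (fun v => dual (vec v)).
Proof.
have coordc j : continuous (fun v : 'rV[R]_#|J| => vec v j).
  by move=> v; exact: coord_continuous.
have sumc (I : finType) (F : I -> 'rV[R]_#|J| -> R) :
    (forall i, continuous (F i)) -> continuous (fun v => \sum_i F i v).
  by move=> Fc v; apply: (@cvg_big R^o) => [||i _]; [exact: add_continuous|exact: nbhs_filter|exact: Fc].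
have mulc c (F : 'rV[R]_#|J| -> R) : continuous F ->
    continuous (fun v => c * F v).
  by move=> Fc v; apply: cvgMl_tmp; [exact: nbhs_filter|exact: Fc].
have cmul c (F : 'rV[R]_#|J| -> R) : continuous F ->
    continuous (fun v => F v * c).
  by move=> Fc v; apply: cvgMr_tmp; [exact: nbhs_filter|exact: Fc].
have lin : continuous (fun v => \sum_j vec v j * b j).
  by apply: (sumc _ (fun j v => vec v j * b j)) => j; exact: cmul.
have tiltc e : continuous (fun v => tilt (vec v) e).
  by apply: (sumc _ (fun j v => vec v j * a j e)) => j; exact: cmul.
have expc : continuous (fun v => \sum_e w e * upd (vec v) e).
  apply: (sumc _ (fun e v => w e * upd (vec v) e)) => e.
  apply: (mulc _); apply: (mulc _).
  have dc := cmul (w e)^-1 _ (tiltc e).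
  by move=> v; apply: continuous_comp; [exact: dc|exact: continuous_expR].
move=> v; apply: cvgB; [exact: nbhs_filter|exact: lin|exact: expc].
Qed.

Let dual_max : exists l : J -> R, (forall j, 0 <= l j) /\
  forall m, (forall j, 0 <= m j) -> dual m <= dual l.
Proof.
pose A := [set v : 'rV[R]_#|J| | forall i, `[0, B]%classic (v ord0 i)]%classic.
have Ac : compact A.
  apply: (@rV_compact _ _ (fun=> `[0, B]%classic)) => _.
  exact: segment_compact.
have A0 : (A !=set0)%classic.
  by exists 0 => i /=; rewrite mxE in_itv /= lexx B0.
have [] := compact_EVT_max A0 Ac (f := fun v => dual (vec v)).
  by apply: continuous_subspaceT; exact: dual_cont.
move=> v /set_mem vA vmax; exists (vec v); split.
  by move=> j; have := vA (enum_rank j); rewrite /= in_itv /= => /andP[].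
have zA : dual0 <= dual (vec v).
  have -> : dual0 = dual (vec 0).
    congr dual; apply/funext => j; by rewrite /vec mxE.
  by apply: vmax; apply/mem_set => i /=; rewrite mxE in_itv /= lexx B0.
move=> m m0; have [/forallP mB|] := boolP [forall j, m j <= B].
  have -> : dual m = dual (vec (\row_i m (enum_val i))).
    by congr dual; apply/funext => j; rewrite /vec mxE enum_rankK.
  by apply: vmax; apply/mem_set => i /=; rewrite mxE in_itv /= m0 mB.
rewrite negb_forall => /existsP[j]; rewrite -ltNge => Bm.
by apply: le_trans zA; apply: ltW; exact: outside Bm.
Qed.

Let dual_perturb l j h : let l' := fun i => l i + (if i == j then h else 0) in
  (forall e, `|h * a j e / w e| <= 2^-1) -> dual l' <= dual l ->
  h * (b j - \sum_e a j e * upd l e)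
    <= h ^+ 2 * (2 * \sum_e (a j e) ^+ 2 / w e * upd l e).
Proof.
move=> l' hs ll.
have tl e : tilt l' e = tilt l e + h * a j e.
  rewrite /tilt /l'; under eq_bigr do rewrite mulrDl.
  rewrite big_split /=; congr (_ + _).
  rewrite (bigD1 j)//= eqxx big1 ?addr0// => i /negbTE ->.
  by rewrite mul0r.
have lb : \sum_i l' i * b i = \sum_i l i * b i + h * b j.
  rewrite /l'; under eq_bigr do rewrite mulrDl.
  rewrite big_split /=; congr (_ + _).
  rewrite (bigD1 j)//= eqxx big1 ?addr0// => i /negbTE ->.
  by rewrite mul0r.
have ub e : w e * upd l' e <= w e * upd l e + h * (a j e * upd l e)
    + h ^+ 2 * (2 * ((a j e) ^+ 2 / w e * upd l e)).
  have := expR_le_quadratic (hs e).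
  have -> : upd l' e = upd l e * expR (h * a j e / w e).
    by rewrite /upd tl mulrDl expRD mulrA.
  have u0 : 0 < w e * upd l e by rewrite mulr_gt0// mulr_gt0// expR_gt0.
  rewrite -(ler_pM2l u0) mulrA => /le_trans; apply.
  rewrite le_eqVlt; apply/orP; left; apply/eqP.
  by field; rewrite gt_eqF.
have : \sum_e w e * upd l' e <= \sum_e (w e * upd l e + h * (a j e * upd l e)
    + h ^+ 2 * (2 * ((a j e) ^+ 2 / w e * upd l e))) by apply: ler_sum.
rewrite !big_split /= -!mulr_sumr.
move: ll; rewrite /dual lb mulrBr; lra.
Qed.

(** At a dual maximizer, raising a multiplier is always allowed and yields feasibility; lowering it
    is allowed as long as it is positive and yields tightness. *)
Lemma entropic_kkt : exists l : J -> R,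
  let z := fun e => x e * expR ((\sum_j l j * a j e) / w e) in
  [/\ forall j, 0 <= l j, forall j, b j <= \sum_e a j e * z e
    & forall j, 0 < l j -> \sum_e a j e * z e = b j].
Proof.
have [l [l0 lmax]] := dual_max; exists l => z.
pose s j := \sum_e `|a j e| / w e.
have s0 j : 0 <= s j by apply: sumr_ge0 => e _; rewrite divr_ge0// ltW.
pose h0 j := (2 * (s j + 1))^-1.
have h00 j : 0 < h0 j by rewrite invr_gt0; have := s0 j; lra.
have small j h : `|h| <= h0 j -> forall e, `|h * a j e / w e| <= 2^-1.
  move=> hh e; rewrite !normrM normfV (gtr0_norm (w0 e)) -mulrA.
  apply: (@le_trans _ _ (h0 j * s j)).
    apply: ler_pM => //; first by rewrite divr_ge0// ltW.
    rewrite /s (bigD1 e)//= lerDl; apply: sumr_ge0 => i _.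
    by rewrite divr_ge0// ltW.
  have -> : (2^-1 : R) = h0 j * (s j + 1).
    by rewrite /h0 invfM -mulrA mulVf ?mulr1// gt_eqF//; have := s0 j; lra.
  by rewrite ler_wpM2l// ?ltW//; lra.
pose K j := 2 * \sum_e (a j e) ^+ 2 / w e * upd l e.
have K0 j : 0 <= K j.
  rewrite mulr_ge0// sumr_ge0// => e _.
  by rewrite mulr_ge0// ?divr_ge0 ?sqr_ge0// ?mulr_ge0 ?expR_ge0// ltW.
have le_b j : b j <= \sum_e a j e * z e.
  rewrite -subr_le0; apply: (le0_of_quadratic (h00 j) (K0 j)) => h hp hh.
  apply: dual_perturb; first by apply: small; rewrite gtr0_norm.
  by apply: lmax => i; rewrite addr_ge0//; case: eqP => // _; exact: ltW.
split=> // j lj; apply/eqP; rewrite eq_le le_b andbT -subr_le0.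
have m0 : 0 < Num.min (l j) (h0 j) by rewrite lt_min lj h00.
apply: (le0_of_quadratic m0 (K0 j)) => h hp.
rewrite le_min => /andP[hl hh].
rewrite -(sqrrN h) -[X in X <= _]mulrNN opprB.
apply: dual_perturb; first by apply: small; rewrite normrN gtr0_norm.
apply: lmax => i; case: eqP => [->|_]; last by rewrite addr0.
by rewrite subr_ge0.
Qed.

End entropic_kkt.

(** * Rooted trees *)

Definition rooting (X : finType) (rho : X) (par : X -> X) (dep : X -> nat) :=
  par rho = rho /\ forall v, v != rho -> (dep (par v) < dep v)%N.

Definition subtree (X : finType) (par : X -> X) (v : X) : {set X} :=
  [set x | fconnect par x v].

Definition is_child (X : finType) (rho : X) (par : X -> X) (u v : X) :=
  (v != rho) && (par v == u).

Section rooting_theory.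
Variables (X : finType) (rho : X) (par : X -> X) (dep : X -> nat).
Hypothesis rooted : rooting rho par dep.
Local Notation T := (subtree par).
Local Notation child := (is_child rho par).

Lemma subtree_refl v : v \in T v.
Proof. by rewrite inE connect0. Qed.

Lemma iter_root i : iter i par rho = rho.
Proof. by elim: i => //= i ->; case: rooted. Qed.

Lemma root_subtree v : (rho \in T v) = (v == rho).
Proof.
apply/idP/eqP => [|->]; last exact: subtree_refl.
by rewrite inE => /iter_findex <-; rewrite iter_root.
Qed.

Lemma subtree_step b v : (b \in T v) = (b == v) || (par b \in T v).
Proof.
apply/idP/orP => [|[/eqP->|]]; last 2 first.
- exact: subtree_refl.
- by rewrite !inE => h; apply: connect_trans h; exact: fconnect1.
rewrite !inE => h; have := iter_findex h.
case: (findex _ _ _) => [/= ->|n]; first by rewrite eqxx; left.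
by rewrite iterSr => <-; right; exact: fconnect_iter.
Qed.

Lemma dep_ind (P : X -> Prop) :
  (forall x, (forall y, (dep y < dep x)%N -> P y) -> P x) -> forall x, P x.
Proof.
move=> H x; have [n] := ubnP (dep x).
elim: n x => // n IH x xn; apply: H => y yx; apply: IH.
exact: leq_trans yx _.
Qed.

Lemma subtree_root x : x \in T rho.
Proof.
elim/dep_ind: x => x IH; rewrite subtree_step.
have [//|xr /=] := eqVneq x rho.
by apply: IH; case: rooted => _; apply.
Qed.

Lemma dep_subtree x v : x \in T v -> (dep v <= dep x)%N.
Proof.
elim/dep_ind: x => x IH; rewrite subtree_step.
have [->//|xv /= h] := eqVneq x v.
have [xr|xr] := eqVneq x rho.
  move: h; rewrite xr; case: rooted => -> _.
  by rewrite root_subtree -xr eq_sym (negbTE xv).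
have lt : (dep (par x) < dep x)%N by case: rooted => _; apply.
exact: leq_trans (IH _ lt h) (ltnW lt).
Qed.

Lemma par_notin b : b != rho -> par b \notin T b.
Proof.
move=> br; apply/negP => /dep_subtree.
by rewrite leqNgt; case: rooted => _ ->.
Qed.

Lemma child_exists u x : x \in T u -> x != u ->
  exists2 v, child u v & x \in T v.
Proof.
elim/dep_ind: x => x IH xT xu.
have xr : x != rho.
  by apply: contraNneq xu => xr; move: xT; rewrite xr root_subtree eq_sym.
have [pu|pu] := eqVneq (par x) u.
  by exists x; rewrite ?subtree_refl// /is_child xr pu eqxx.
have lt : (dep (par x) < dep x)%N by case: rooted => _; apply.
move: xT; rewrite subtree_step (negbTE xu) /= => /(IH _ lt)/(_ pu)[v cv pv].
by exists v => //; rewrite subtree_step pv orbT.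
Qed.

Lemma child_uniq u x v v' : child u v -> child u v' -> x \in T v -> x \in T v' ->
  v = v'.
Proof.
move=> /andP[vr /eqP pv] /andP[vr' /eqP pv'].
elim/dep_ind: x => x IH.
rewrite subtree_step [_ \in T v']subtree_step.
have [xv|xv] := eqVneq x v; have [xv'|xv'] := eqVneq x v'; rewrite //=.
- by rewrite -xv -xv'.
- by rewrite xv pv -pv' => _ h; have := par_notin vr'; rewrite h.
- by rewrite xv' pv' -pv => h _; have := par_notin vr; rewrite h.
move=> h h'; have [xr|xr] := eqVneq x rho.
  move: h; rewrite xr; case: rooted => -> _.
  by rewrite root_subtree -xr eq_sym (negbTE xv).
by apply: (IH (par x)) => //; case: rooted => _; apply.
Qed.

Lemma child_subtree u v x : child u v -> x \in T v -> (x \in T u) && (x != u).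
Proof.
move=> /andP[vr /eqP pv] xv.
have vu : v \in T u by rewrite subtree_step pv subtree_refl orbT.
apply/andP; split.
  by move: xv vu; rewrite !inE; exact: connect_trans.
by apply: contraTneq xv => ->; rewrite -pv par_notin.
Qed.

Lemma sum_subtree (V : nmodType) (F : X -> V) u :
  (\sum_(x in T u) F x = F u + \sum_(v | child u v) \sum_(x in T v) F x)%R.
Proof.
rewrite (bigD1 u) ?subtree_refl//=; congr (_ + _)%R.
rewrite (exchange_big_dep (fun x => (x \in T u) && (x != u))) /=; last first.
  by move=> v x; exact: child_subtree.
apply: eq_bigr => x /andP[xT xu].
have [v cv xv] := child_exists xT xu.
rewrite (big_pred1 v)// => v' /=.
apply/andP/eqP => [[cv' xv']|->//].
exact: child_uniq cv' cv xv' xv.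
Qed.

End rooting_theory.

Section tree_rooting.
Variables (X : finType) (e : rel X) (rho : X).
Hypothesis tree : is_tree e.

Let reach v n := [exists p : n.-tuple X, path e rho p && (last rho p == v)].

Let reachP v (p : seq X) : path e rho p -> last rho p = v -> reach v (size p).
Proof. by move=> ep lp; apply/existsP; exists (in_tuple p); rewrite /= ep lp eqxx. Qed.

Let reach_ex v : exists n, reach v n.
Proof.
case: tree => _ /(_ rho v)/connectP[p ep lp] _.
by exists (size p); exact: reachP.
Qed.

Let dep v := ex_minn (reach_ex v).

Let dep_le v (p : seq X) : path e rho p -> last rho p = v -> (dep v <= size p)%N.
Proof.
by move=> ep lp; rewrite /dep; case: ex_minnP => m _; apply; exact: reachP.
Qed.

Let parent_ex v : v != rho -> exists u, e u v && (dep u < dep v)%N.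
Proof.
move=> vr.
have [p ep [lp ->]] : exists2 p, path e rho p & last rho p = v /\ dep v = size p.
  rewrite /dep; case: ex_minnP => m /existsP[p /andP[ep /eqP lp]] _.
  by exists p => //; rewrite size_tuple.
case: p ep lp => [|y q] ep lp.
  by move: vr; rewrite -lp eqxx.
move: ep lp; case/lastP: q => [|q z].
  move=> /= /andP[ey _] yv; exists rho; rewrite -yv ey /=.
  by rewrite ltnS; apply: (@dep_le _ [::]).
rewrite -rcons_cons rcons_path last_rcons size_rcons => /andP[ep el] zv.
by exists (last rho (y :: q)); rewrite -zv el /= ltnS; exact: (dep_le ep erefl).
Qed.

Let par v := if v == rho then rho else odflt v [pick u | e u v && (dep u < dep v)%N].

Let parP v : v != rho -> e (par v) v /\ (dep (par v) < dep v)%N.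
Proof.
move=> vr; rewrite /par (negbTE vr); case: pickP => [u /andP//|h].
by have [u] := parent_ex vr; rewrite h.
Qed.

Let rooted : rooting rho par dep.
Proof. by split=> [|v /parP[]//]; rewrite /par eqxx. Qed.

Let dep_hop v : (dep v <= hop_diameter e)%N.
Proof.
case: tree => _ /(_ rho v)/connectP[p ep lp] _.
case/shortenP: ep lp => q eq uq _ lq.
apply: leq_trans (dep_le eq (esym lq)) _.
have sz : (size q < #|X|)%N by rewrite -[(size q).+1]/(size (rho :: q)) -(card_uniqP uq) max_card.
apply: (@leq_bigmax_cond _ _ (fun m : 'I_#|X| => nat_of_ord m) (Ordinal sz)).
by apply/existsP; exists rho; apply/existsP; exists (in_tuple q); rewrite eq uq.
Qed.

Let esym_ : symmetric e. Proof. by case: tree => -[]. Qed.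

Let climb x i : (forall a, (a < i)%N -> iter a par x != rho) ->
  path e x (traject par (par x) i).
Proof.
elim: i x => //= i IH x h.
have [ex _] := parP (h 0%N isT); rewrite esym_ ex /=; apply: IH => a ai.
by rewrite -iterSr; exact: (h a.+1).
Qed.

Let nonroot x z : fconnect par x z ->
  forall a, (a < findex par x z)%N -> iter a par x != rho.
Proof.
move=> xz a ai; apply: contraTneq (ai) => ar.
have iE := iter_findex xz.
have zr : z = rho.
  by rewrite -iE -(subnK (ltnW ai)) iterD ar (iter_root rooted).
by rewrite -leqNgt zr -ar findex_iter ?leqnn// (ltn_trans ai)// findex_max.
Qed.

Let uniq_climb x z : fconnect par x z -> uniq (traject par x (findex par x z).+1).
Proof.
move=> /findex_max h; rewrite -(take_traject _ _ h).
by apply: take_uniq; exact: orbit_uniq.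
Qed.

(* Otherwise the climbs from both ends up to their first common vertex [z]
   close up with the edge to a cycle of size at least 3. *)
Let edge_par x y : e x y -> (y != rho) && (par y == x) || (x != rho) && (par x == y).
Proof.
move=> exy.
have cxr : fconnect par x rho && fconnect par y rho.
  by have := subtree_root rooted x; have := subtree_root rooted y; rewrite !inE => -> ->.
case: (@arg_minnP _ rho (fun z => fconnect par x z && fconnect par y z)
  (fun z => findex par x z) cxr) => z /andP[xz yz] zmin.
set i := findex par x z in zmin; set j := findex par y z.
have ilt : (i < order par x)%N by exact: findex_max.
have jlt : (j < order par y)%N by exact: findex_max.
have iE : iter i par x = z by exact: iter_findex.
have jE : iter j par y = z by exact: iter_findex.
have uc : ucycle e (x :: traject par (par x) i ++ rev (traject par y j)).
  apply/andP; split.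
    rewrite /= rcons_cat cat_path climb; last exact: nonroot.
    rewrite last_traject iE -rev_cons.
    have -> : z = last x (rcons (traject par y j) z) by rewrite last_rcons.
    have -> : x :: traject par y j = belast x (rcons (traject par y j) z).
      by rewrite belast_rcons.
    rewrite rev_path -{1}jE -trajectSr trajectS /= (eq_path (e' := e)); last first.
      by move=> a b /=; rewrite esym_.
    by rewrite esym_ exy; apply: climb; exact: nonroot.
  rewrite -cat_cons -trajectS cat_uniq rev_uniq uniq_climb//=.
  have := uniq_climb yz; rewrite trajectSr rcons_uniq => /andP[_ ->].
  rewrite andbT; apply/hasPn => u; rewrite mem_rev => /trajectP[b bj ->].
  rewrite -trajectS; apply/negP => /trajectP[a ai aE].
  have h : fconnect par x (iter b par y) && fconnect par y (iter b par y).
    by rewrite {1}aE !fconnect_iter.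
  have := zmin _ h; rewrite aE findex_iter; last exact: leq_ltn_trans ilt.
  move=> ia; have ai' : a = i by apply/eqP; rewrite eqn_leq ia -ltnS ai.
  have : findex par y (iter b par y) = j by rewrite aE ai' iE.
  by rewrite findex_iter ?(ltn_trans bj)// => bE; rewrite bE ltnn in bj.
(* The cycle has [i + j + 1] vertices, so acyclicity leaves [i + j <= 1]: the ends coincide, or one
   is the parent of the other. *)
case: tree => -[_ irr] _ /(_ _ uc).
rewrite /= size_cat size_rev !size_traject.
move: iE jE (nonroot xz) (nonroot yz); rewrite -/i -/j.
case: i {ilt zmin uc} => [|[|i]]; case: j {jlt} => [|[|j]] //=.
- by move=> <- yx; rewrite yx irr in exy.
- by move=> <- -> _ /(_ 0%N isT) /= ->; rewrite eqxx.
- by move=> <- -> /(_ 0%N isT) /= -> ; rewrite eqxx orbT.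
Qed.

(** The depth is the hop distance to [rho], attained on a simple path, hence the last bound.
    Acyclicity enters only in showing that every edge joins a vertex to its parent. *)
Lemma tree_rooting : exists (par : X -> X) (dep : X -> nat),
  [/\ rooting rho par dep,
      forall x y, e x y = (y != rho) && (par y == x) || (x != rho) && (par x == y)
    & forall v, (dep v <= hop_diameter e)%N].
Proof.
exists par, dep; split=> // x y; apply/idP/idP; first exact: edge_par.
case/orP => /andP[/parP[ev _] /eqP <-]; first by [].
by rewrite esym_.
Qed.

End tree_rooting.

(** * Earthmover distance on a tree *)

Definition plan_cost (R : realType) (X : finType) (d f : X -> X -> R) : R :=
  \sum_x \sum_y f x y * d x y.

Definition mass_in (R : realType) (X : finType) (par : X -> X) (u : X -> R) (v : X) : R :=
  \sum_(x in subtree par v) u x.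

(** Closed form of the earthmover distance on a tree: the edge above [y] has to carry exactly the
    imbalance of the subtree of [y]. *)
Definition cut_dist (R : realType) (X : finType) (rho : X) (par : X -> X)
    (len : X -> X -> R) (u v : X -> R) : R :=
  \sum_(y | y != rho) len y (par y) * `|mass_in par u y - mass_in par v y|.

Section plans.
Variables (R : realType) (X : finType) (d : X -> X -> R).
Hypotheses (d0 : forall x y, 0 <= d x y).
Hypothesis dtri : forall x y z, d x z <= d x y + d y z.

Lemma plan_cost_ge0 u v f : transport_plan u v f -> 0 <= plan_cost d f.
Proof.
case=> f0 _ _; apply: sumr_ge0 => x _; apply: sumr_ge0 => y _.
exact: mulr_ge0.
Qed.

Lemma earthmover_le_plan u v f :
  transport_plan u v f -> earthmover d u v <= plan_cost d f.
Proof.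
move=> fp; apply: ge_inf; last by exists f.
by exists 0 => c [g [gp ->]]; exact: plan_cost_ge0 gp.
Qed.

(** The mass passing through [y] is redistributed proportionally. Where [v y] is 0, both [f x y] and
    [g y t] vanish, so the convention on division by zero is harmless. *)
Lemma glue_plans u v z f g : transport_plan u v f -> transport_plan v z g ->
  exists2 h, transport_plan u z h & plan_cost d h <= plan_cost d f + plan_cost d g.
Proof.
move=> [f0 fu fv] [g0 gv gz].
pose h x t := \sum_y f x y * g y t / v y.
have v0 y : 0 <= v y by rewrite -fv sumr_ge0.
have cancelf x y : f x y * (v y / v y) = f x y.
  have [vy|vy] := eqVneq (v y) 0; last by rewrite divff// mulr1.
  suff -> : f x y = 0 by rewrite mul0r.
  apply/eqP; rewrite eq_le f0 andbT -vy -fv (bigD1 x)//= lerDl.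
  by apply: sumr_ge0.
have cancelg y t : (v y / v y) * g y t = g y t.
  have [vy|vy] := eqVneq (v y) 0; last by rewrite divff// mul1r.
  suff -> : g y t = 0 by rewrite mulr0.
  apply/eqP; rewrite eq_le g0 andbT -vy -gv (bigD1 t)//= lerDl.
  by apply: sumr_ge0.
have hf x y : \sum_t f x y * g y t / v y = f x y.
  by rewrite -mulr_suml -mulr_sumr gv -mulrA cancelf.
have hg y t : \sum_x f x y * g y t / v y = g y t.
  by rewrite -mulr_suml -mulr_suml fv mulrAC cancelg.
exists h.
  split=> [x t|x|t].
  - by apply: sumr_ge0 => y _; rewrite divr_ge0 ?mulr_ge0.
  - by rewrite exchange_big -fu; apply: eq_bigr => y _; exact: hf.
  - by rewrite exchange_big -gz; apply: eq_bigr => y _; exact: hg.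
have -> : plan_cost d f = \sum_x \sum_t \sum_y f x y * g y t / v y * d x y.
  apply: eq_bigr => x _; rewrite exchange_big; apply: eq_bigr => y _ /=.
  by rewrite -mulr_suml hf.
have -> : plan_cost d g = \sum_x \sum_t \sum_y f x y * g y t / v y * d y t.
  rewrite /plan_cost exchange_big [RHS]exchange_big; apply: eq_bigr => t _.
  rewrite exchange_big; apply: eq_bigr => y _ /=.
  by rewrite -mulr_suml hg.
rewrite -big_split; apply: ler_sum => x _; rewrite -big_split; apply: ler_sum => t _.
rewrite mulr_suml -big_split; apply: ler_sum => y _ /=.
rewrite -mulrDr ler_wpM2l//.
by rewrite divr_ge0 ?mulr_ge0.
Qed.

End plans.

Section tree_metric.
Variables (R : realType) (X : finType) (e : rel X) (len : X -> X -> R).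
Variables (rho : X) (par : X -> X) (dep : X -> nat).
Hypothesis rooted : rooting rho par dep.
Hypothesis edgeE : forall x y,
  e x y = (y != rho) && (par y == x) || (x != rho) && (par x == y).
Hypothesis lenP : edge_lengths e len.
Hypothesis conn : forall x y, connect e x y.
Local Notation T := (subtree par).
Local Notation d := (path_dist e len).
Local Notation wt v := (len v (par v)).
Local Notation mass := (mass_in par).
Local Notation cut := (cut_dist rho par len).

Lemma edge_to_par v : v != rho -> e v (par v).
Proof. by move=> vr; rewrite edgeE vr eqxx orbT. Qed.

Lemma parent_len_ge0 v : v != rho -> 0 <= wt v.
Proof. by move=> /edge_to_par/lenP[]. Qed.

Lemma subtree_par v y : y != rho -> v != y -> (par y \in T v) = (y \in T v).
Proof. by move=> yr vy; rewrite [in RHS]subtree_step eq_sym (negbTE vy). Qed.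

Lemma walk_length_ge0 x p : path e x p -> 0 <= walk_length len x p.
Proof.
elim: p x => //= y p IH x /andP[exy ep].
by rewrite addr_ge0 ?IH//; case: (lenP exy).
Qed.

(** The edge between [b] and its parent is cut by the subtree of [b] and by no other, so a single
    term of the sum survives. *)
Lemma edge_crossing x y : e x y ->
  \sum_(v | v != rho) wt v * `|(x \in T v)%:R - (y \in T v)%:R| <= len x y.
Proof.
have H b : b != rho -> \sum_(v | v != rho)
    wt v * `|(b \in T v)%:R - (par b \in T v)%:R| = wt b.
  move=> br; rewrite (bigD1 b)//= subtree_refl (negbTE (par_notin rooted br)).
  rewrite subr0 normr1 mulr1 big1 ?addr0// => v /andP[vr vb].
  by rewrite subtree_par// subrr normr0 mulr0.
move=> exy; have [_ ls] := lenP exy; move: exy.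
rewrite edgeE => /orP[]/andP[zr /eqP zp].
  under eq_bigr do rewrite distrC.
  by rewrite ls -{1 2}zp H// zp.
by rewrite -zp H.
Qed.

Lemma walk_crossing x p : path e x p ->
  \sum_(v | v != rho) wt v * `|(x \in T v)%:R - (last x p \in T v)%:R|
  <= walk_length len x p.
Proof.
elim: p x => [|y p IH] x /=.
  by move=> _; rewrite big1// => v _; rewrite subrr normr0 mulr0.
move=> /andP[exy ep].
apply: le_trans (lerD (edge_crossing exy) (IH _ ep)).
rewrite -big_split /=; apply: ler_sum => v vr.
by rewrite -mulrDr ler_wpM2l ?parent_len_ge0// ler_distD.
Qed.

Lemma path_dist_crossing x y :
  \sum_(v | v != rho) wt v * `|(x \in T v)%:R - (y \in T v)%:R| <= d x y.
Proof.
apply: lb_le_inf.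
  have /connectP[p ep lp] := conn x y.
  by exists (walk_length len x p), p.
by move=> c [p [ep <- ->]]; exact: walk_crossing.
Qed.

Lemma path_dist_le_walk x p : path e x p -> d x (last x p) <= walk_length len x p.
Proof.
move=> ep; apply: ge_inf; last by exists p.
by exists 0 => c [q [eq _ ->]]; exact: walk_length_ge0.
Qed.

Lemma path_dist_ge0 x y : 0 <= d x y.
Proof.
apply: lb_le_inf.
  have /connectP[p ep lp] := conn x y.
  by exists (walk_length len x p), p.
by move=> c [p [ep _ ->]]; exact: walk_length_ge0.
Qed.

Lemma path_dist_refl x : d x x = 0.
Proof.
by apply/eqP; rewrite eq_le path_dist_ge0 (@path_dist_le_walk x [::]).
Qed.

Lemma path_dist_edge x y : e x y -> d x y <= len x y.
Proof.
by move=> exy; have := @path_dist_le_walk x [:: y]; rewrite /= addr0 exy; apply.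
Qed.

Lemma walk_length_cat x p q :
  walk_length len x (p ++ q) = walk_length len x p + walk_length len (last x p) q.
Proof. by elim: p x => [|y p IH] x /=; rewrite ?add0r// IH addrA. Qed.

Lemma path_dist_triangle x y z : d x z <= d x y + d y z.
Proof.
rewrite -lerBlDr; apply: lb_le_inf.
  have /connectP[p ep lp] := conn x y.
  by exists (walk_length len x p), p.
move=> c [p [ep py ->]]; rewrite lerBlDr -lerBlDl; apply: lb_le_inf.
  have /connectP[q eq lq] := conn y z.
  by exists (walk_length len y q), q.
move=> c' [q [eq qz ->]]; rewrite lerBlDl.
have := @path_dist_le_walk x (p ++ q).
by rewrite cat_path last_cat walk_length_cat ep py qz eq; apply.
Qed.

Lemma mass_in_root (u : X -> R) : mass u rho = \sum_x u x.
Proof. by apply: eq_bigl => x; exact: subtree_root rooted _. Qed.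

Lemma cut_dist_le_plan u v f : transport_plan u v f -> cut u v <= plan_cost d f.
Proof.
move=> [f0 fu fv].
have mE y : mass u y - mass v y =
    \sum_x \sum_z f x z * ((x \in T y)%:R - (z \in T y)%:R).
  rewrite /mass_in [X in X - _]big_mkcond [X in _ - X]big_mkcond /=.
  have -> : \sum_x (if x \in T y then u x else 0) = \sum_x \sum_z f x z * (x \in T y)%:R.
    apply: eq_bigr => x _; rewrite -mulr_suml fu.
    by case: ifP => _; rewrite ?mulr1 ?mulr0.
  have -> : \sum_z (if z \in T y then v z else 0) = \sum_x \sum_z f x z * (z \in T y)%:R.
    rewrite exchange_big; apply: eq_bigr => z _; rewrite -mulr_suml fv.
    by case: ifP => _; rewrite ?mulr1 ?mulr0.
  rewrite -sumrB; apply: eq_bigr => x _; rewrite -sumrB; apply: eq_bigr => z _.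
  by rewrite mulrBr.
apply: (@le_trans _ _ (\sum_x \sum_z f x z *
    \sum_(y | y != rho) wt y * `|(x \in T y)%:R - (z \in T y)%:R|)); last first.
  apply: ler_sum => x _; apply: ler_sum => z _.
  by rewrite ler_wpM2l// path_dist_crossing.
under [leRHS]eq_bigr do (under eq_bigr do rewrite mulr_sumr; rewrite exchange_big).
rewrite [leRHS]exchange_big /=; apply: ler_sum => y yr.
rewrite mE; under [leRHS]eq_bigr do under eq_bigr do rewrite mulrCA.
under [leRHS]eq_bigr do rewrite -mulr_sumr.
rewrite -mulr_sumr ler_wpM2l ?parent_len_ge0//.
apply: le_trans (ler_norm_sum _ _ _) _; apply: ler_sum => x _.
apply: le_trans (ler_norm_sum _ _ _) _; apply: ler_sum => z _.
by rewrite normrM ger0_norm.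
Qed.

Let lift_mass (u : X -> R) y a x := u x - a * (x == y)%:R + a * (x == par y)%:R.

Let sum_eqr (F : X -> R) y : \sum_x F x * (x == y)%:R = F y.
Proof.
rewrite (bigD1 y)//= eqxx mulr1 big1 ?addr0// => x /negbTE ->.
by rewrite mulr0.
Qed.

Let sum_eql (F : X -> R) y : \sum_x F x * (y == x)%:R = F y.
Proof. by rewrite -[RHS](sum_eqr F); apply: eq_bigr => x _; rewrite eq_sym. Qed.

Let lift_mass_in u y a z : y != rho ->
  mass (lift_mass u y a) z = mass u z - a * (z == y)%:R.
Proof.
move=> yr; rewrite /mass_in /lift_mass big_split sumrB /= -addrA; congr (_ + _).
have H b : \sum_(x in T z) a * (x == b)%:R = a * (b \in T z)%:R.
  rewrite -mulr_sumr; congr (_ * _); rewrite big_mkcond /=.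
  rewrite -(sum_eqr (fun x => (x \in T z)%:R)); apply: eq_bigr => x _.
  by case: (x \in T z); rewrite ?mul1r ?mul0r.
rewrite !H; have [->|zy] := eqVneq z y.
  by rewrite subtree_refl (negbTE (par_notin rooted yr)) mulr0 addr0.
by rewrite subtree_par// mulr0 addNr oppr0.
Qed.

(** Both directions are needed: a surplus of the source is pushed up before the remaining plan, a
    surplus of the target is brought down after it. *)
Let lift_plan u y a : y != rho -> (forall x, 0 <= u x) -> 0 <= a <= u y ->
  exists f, [/\ transport_plan u (lift_mass u y a) f,
    transport_plan (lift_mass u y a) u (fun x z => f z x),
    plan_cost d f <= wt y * a & plan_cost d (fun x z => f z x) <= wt y * a].
Proof.
move=> yr u0 /andP[a0 au].
have [l0 ls] := lenP (edge_to_par yr).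
pose q x := u x - a * (x == y)%:R.
have q0 x : 0 <= q x.
  by rewrite subr_ge0; case: eqP => [->|_]; rewrite ?mulr1 ?mulr0.
pose f x z := q x * (x == z)%:R + a * (x == y)%:R * (z == par y)%:R.
have f0 x z : 0 <= f x z by rewrite addr_ge0 ?mulr_ge0.
have fu x : \sum_z f x z = u x.
  rewrite big_split /= (sum_eql (fun=> q x)) (sum_eqr (fun=> a * _)).
  by rewrite /q subrK.
have fv z : \sum_x f x z = lift_mass u y a z.
  rewrite big_split /= sum_eqr; congr (_ + _).
  under eq_bigr do rewrite mulrAC.
  by rewrite (sum_eqr (fun=> _)).
exists f; split; first by split.
- by split.
- rewrite /plan_cost /f; under eq_bigr do under eq_bigr do rewrite mulrDl.
  under eq_bigr do rewrite big_split /=.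
  rewrite big_split /= big1 ?add0r; last first.
    move=> x _; rewrite big1// => z _; case: eqP => [->|_]; last by rewrite mulr0 mul0r.
    by rewrite path_dist_refl mulr0.
  under eq_bigr do under eq_bigr do rewrite mulrAC.
  under eq_bigr do rewrite sum_eqr mulrAC.
  rewrite sum_eqr mulrC ler_wpM2r//; apply: path_dist_edge; exact: edge_to_par.
- rewrite /plan_cost exchange_big /f; under eq_bigr do under eq_bigr do rewrite mulrDl.
  under eq_bigr do rewrite big_split /=.
  rewrite big_split /= big1 ?add0r; last first.
    move=> x _; rewrite big1// => z _; case: eqP => [->|_]; last by rewrite mulr0 mul0r.
    by rewrite path_dist_refl mulr0.
  under eq_bigr do under eq_bigr do rewrite mulrAC.
  under eq_bigr do rewrite sum_eqr mulrAC.
  rewrite sum_eqr mulrC ler_wpM2r// ls; apply: path_dist_edge.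
  by rewrite edgeE yr eqxx.
Qed.

(* The deepest vertex whose subtree masses differ carries the whole difference
   itself, so that it can be pushed to the parent without creating a deficit. *)
Lemma flow_plan u v : (forall x, 0 <= u x) -> (forall x, 0 <= v x) ->
  \sum_x u x = \sum_x v x ->
  exists2 f, transport_plan u v f & plan_cost d f <= cut u v.
Proof.
pose D (u v : X -> R) := [set y | (y != rho) && (mass u y != mass v y)].
have [n] := ubnP #|D u v|; elim: n u v => // n IH u v Dn u0 v0 uv.
have uvr : mass u rho = mass v rho by rewrite !mass_in_root.
have [D0|[y0 y0D]] := set_0Vmem (D u v).
  have E y : mass u y = mass v y.
    have [->//|yr] := eqVneq y rho.
    apply/eqP; have := finset.in_set0 y; rewrite -D0 inE yr /= => /negbFE//.
  have E1 y : u y = v y.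
    have := E y; rewrite /mass_in !(sum_subtree rooted).
    have -> : \sum_(z | is_child rho par y z) \sum_(x in T z) u x =
      \sum_(z | is_child rho par y z) \sum_(x in T z) v x.
      by apply: eq_bigr => z _; exact: E.
    by move/addIr.
  exists (fun x z => u x * (x == z)%:R).
    split=> [x z|x|z]; first by rewrite mulr_ge0.
      exact: (sum_eql (fun=> u x)).
    by rewrite sum_eqr.
  rewrite /plan_cost big1; last first.
    move=> x _; rewrite big1// => z _; case: eqP => [->|_]; last by rewrite mulr0 mul0r.
    by rewrite path_dist_refl mulr0.
  by apply: sumr_ge0 => y yr; rewrite mulr_ge0 ?parent_len_ge0.
case: (@arg_maxnP _ y0 (mem (D u v)) dep y0D) => y yD ymax.
have /andP[yr yne] : (y != rho) && (mass u y != mass v y) by move: (yD : y \in D u v); rewrite inE.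
have own : u y - v y = mass u y - mass v y.
  rewrite /mass_in !(sum_subtree rooted).
  have -> : \sum_(z | is_child rho par y z) \sum_(x in T z) u x =
      \sum_(z | is_child rho par y z) \sum_(x in T z) v x.
    apply: eq_bigr => z /andP[zr /eqP zp]; apply/eqP; apply: contraT => zne.
    have : z \in D u v by rewrite inE zr.
    move=> zD; have : (dep z <= dep y)%N by exact: ymax.
    by rewrite leqNgt -zp; case: rooted => _ ->.
  by rewrite opprD addrACA subrr addr0.
have shrink (u' v' : X -> R) :
    (forall z, mass u' z - mass v' z = (mass u z - mass v z) * (z != y)%:R) ->
    (#|D u' v'| < n)%N /\ cut u' v' + wt y * `|mass u y - mass v y| = cut u v.
  move=> H; split.
    rewrite -ltnS; apply: leq_trans Dn; rewrite ltnS; apply: proper_card.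
    apply/properP; split.
      apply/fintype.subsetP => z; rewrite !inE => /andP[-> /=].
      by rewrite -subr_eq0 H mulf_eq0 negb_or subr_eq0 => /andP[].
    by exists y => //; rewrite inE -subr_eq0 H !eqxx mulr0 eqxx andbF.
  rewrite /cut_dist [RHS](bigD1 y)//= [X in X + _ = _](bigD1 y)//=.
  rewrite H eqxx mulr0 normr0 mulr0 add0r addrC; congr (_ + _).
  by apply: eq_bigr => z /andP[_ zy]; rewrite H zy mulr1.
have rny : (rho == y) = false by rewrite eq_sym; exact: negbTE.
have [lt|le] := ltP (mass v y) (mass u y).
  set a := mass u y - mass v y.
  have a0 : 0 <= a by rewrite subr_ge0 ltW.
  have au : 0 <= a <= u y by rewrite a0 /a -own gerBl v0.
  have [f [fp _ fc _]] := lift_plan yr u0 au.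
  have [||||g gp gc] := IH (lift_mass u y a) v.
  - apply: (proj1 (shrink _ _ _)) => z; rewrite lift_mass_in//.
    case: eqP => [->|_]; first by rewrite /= /a; ring.
    by rewrite /=; ring.
  - move=> x; rewrite addr_ge0 ?mulr_ge0// subr_ge0.
    by case: eqP => [->|_]; rewrite ?mulr1 ?mulr0//; case/andP: au.
  - by [].
  - by rewrite -!mass_in_root lift_mass_in// rny mulr0 subr0.
  have [h hp hc] := glue_plans path_dist_triangle fp gp.
  exists h => //; apply: le_trans hc _.
  have [|_ <-] := shrink (lift_mass u y a) v.
    move=> z; rewrite lift_mass_in//.
    case: eqP => [->|_]; first by rewrite /= /a; ring.
    by rewrite /=; ring.
  by rewrite addrC lerD// (ger0_norm a0).
set a := mass v y - mass u y.
have a0 : 0 <= a by rewrite subr_ge0.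
have av : 0 <= a <= v y by rewrite a0 /a -opprB -own opprB gerBl u0.
have [f [_ fp _ fc]] := lift_plan yr v0 av.
have sh z : mass u z - mass (lift_mass v y a) z = (mass u z - mass v z) * (z != y)%:R.
  rewrite lift_mass_in//.
  case: eqP => [->|_]; first by rewrite /= /a; ring.
  by rewrite /=; ring.
have [sn sc] := shrink _ _ sh.
have [||g gp gc] := IH u (lift_mass v y a) sn u0.
- move=> x; rewrite addr_ge0 ?mulr_ge0// subr_ge0.
  by case: eqP => [->|_]; rewrite ?mulr1 ?mulr0//; case/andP: av.
- by rewrite -!mass_in_root lift_mass_in// rny mulr0 subr0.
have [h hp hc] := glue_plans path_dist_triangle gp fp.
exists h => //; apply: le_trans hc _; rewrite -sc lerD//.
by rewrite distrC (ger0_norm a0).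
Qed.

Lemma earthmover_le_cut u v : (forall x, 0 <= u x) -> (forall x, 0 <= v x) ->
  \sum_x u x = \sum_x v x -> earthmover d u v <= cut u v.
Proof.
move=> u0 v0 uv; have [f fp] := flow_plan u0 v0 uv; apply: le_trans.
exact: earthmover_le_plan path_dist_ge0 _ _ _ fp.
Qed.

Lemma cut_le_earthmover u v : (forall x, 0 <= u x) -> (forall x, 0 <= v x) ->
  \sum_x u x = \sum_x v x -> cut u v <= earthmover d u v.
Proof.
move=> u0 v0 uv; have [f fp _] := flow_plan u0 v0 uv.
apply: lb_le_inf; first by exists (plan_cost d f), f.
by move=> c [g [gp ->]]; exact: cut_dist_le_plan.
Qed.

End tree_metric.

(** * Profiles and their projections *)

Lemma sum_nat_lt n a : (\sum_(i < n) (i < a) = minn n a)%N.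
Proof.
elim: n => [|n IH]; first by rewrite big_ord0 min0n.
rewrite big_ord_recr /= IH; lia.
Qed.

Lemma sum_nat_ge n a : (\sum_(i < n) (a <= i) = n - a)%N.
Proof.
elim: n => [|n IH]; first by rewrite big_ord0.
rewrite big_ord_recr /= IH; lia.
Qed.

Section profiles.
Variables (R : realType) (X : finType) (rho : X) (par : X -> X) (dep : X -> nat).
Hypothesis rooted : rooting rho par dep.
Variable k : nat.
Local Notation T := (subtree par).
Local Notation child := (is_child rho par).
Local Notation N := #|X|.

(* The value of a profile at [inl (v, j)] is the anti-mass of the [j]-th slot of
   the subtree of [v], i.e. 1 minus the amount of a server in that slot, slots
   being filled in increasing order; only the slots [j < subsize v] matter. The
   value at [inr u] is the anti-mass of the single point [u]. *)
Definition entry (X : finType) : finType := ((X * 'I_#|X|) + X)%type.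
Local Notation E := (entry X).

Definition subsize v := #|T v|.

Definition bundle_of (e : E) : option X :=
  match e with
  | inl (v, j) => if (v != rho) && (j < subsize v)%N then Some (par v) else None
  | inr u => Some u
  end.

Definition bundle u : {set E} := [set e | bundle_of e == Some u].

Definition slotsum (x : E -> R) (u : X) (s : nat) : R :=
  \sum_(i < N | (i < s)%N) x (inl (u, i)).

(** Any [s] entries of a bundle miss at least as much as the [s] first, fullest slots of [u].
    Quantifying over all subsets, and not only the whole bundle, is what controls individual
    slots. *)
Definition profile (x : E -> R) := forall u (S : {set E}), S \subset bundle u ->
  slotsum x u #|S| <= \sum_(e in S) x e.

(* With this value, capacity [1 - 2 * delta] at the requested point and
   [1 - delta] in each of [k] slots at the root amount, after rescaling by
   [1 - 2 * delta], to mass exactly 1 and [k + 1/2]. *)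
Definition delta : R := (2 * (k%:R + 1))^-1.

(** The value 1 from slot [k] on at the root caps the number of servers. Single points need no
    floor: their bound [2 * delta] survives because only the request constraint lowers them, and it
    stops there. *)
Definition slot_floor (e : E) : R :=
  match e with
  | inl (v, j) => if (v == rho) && (k <= j)%N then 1 else delta
  | inr _ => 0
  end.

Lemma delta_gt0 : 0 < delta.
Proof. by rewrite invr_gt0 mulr_gt0// ltr_wpDl. Qed.

Lemma delta_eq : 2 * (k%:R + 1) * delta = 1.
Proof. by rewrite divff// gt_eqF// mulr_gt0// ltr_wpDl. Qed.

Lemma delta_le : delta <= 2^-1.
Proof. by have := delta_eq; have := delta_gt0; have := ler0n R k; nra. Qed.

Lemma sum_bundle (V : nmodType) (F : E -> V) u :
  \sum_(e in bundle u) F e =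
  F (inr u) + \sum_(v | child u v) \sum_(j < N | (j < subsize v)%N) F (inl (v, j)).
Proof.
rewrite big_mkcond big_sumType /= addrC; congr (_ + _).
  rewrite -big_mkcond (big_pred1 u)// => v /=.
  by rewrite inE /=; apply/eqP/eqP => [[]|->].
rewrite -big_mkcond /= pair_big_dep /=.
rewrite [RHS](eq_bigr (fun p => F (inl p))); last by case.
apply: eq_bigl => -[v j]; rewrite inE /= /is_child.
case: (v != rho) => //=; case: (j < subsize v)%N; rewrite ?andbT ?andbF//.
Qed.

Lemma top_slot u e : e \in bundle u ->
  match e with inl (v, j) => child u v /\ (j < subsize v)%N | inr z => z = u end.
Proof.
rewrite inE; case: e => [[v j]|z] /=; last by move=> /eqP[].
by rewrite /is_child; case: (v != rho) => //=; case: ifP => // _ /eqP[->].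
Qed.

Lemma subsize_le v : (subsize v <= N)%N.
Proof. exact: max_card. Qed.

Lemma big_ord_lt (V : Type) (op : V -> V -> V) idx (F : nat -> V) s :
  (s <= N)%N -> \big[op/idx]_(i < N | (i < s)%N) F i = \big[op/idx]_(i < s) F i.
Proof. by move=> sN; rewrite (big_ord_widen _ F sN). Qed.

Lemma card_bundle u : #|bundle u| = subsize u.
Proof.
rewrite -sum1_card (sum_bundle (fun=> 1%N)) /= /subsize -[RHS]sum1_card.
rewrite [RHS](sum_subtree rooted); congr (_ + _)%N.
apply: eq_bigr => v _.
by rewrite (big_ord_lt _ _ (fun=> 1%N)) ?subsize_le// !sum1_card card_ord.
Qed.

Lemma card_sub_bundle u (S : {set E}) : S \subset bundle u -> (#|S| <= subsize u)%N.
Proof. by move=> /subset_leq_card; rewrite card_bundle. Qed.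

(** * Integral configurations as profiles *)

Definition vacant (A : {set X}) (e : E) : bool :=
  match e with
  | inl (v, j) => (#|A :&: T v| <= j)%N
  | inr u => u \notin A
  end.

Definition anti (A : {set X}) (e : E) : R := (vacant A e)%:R.

Lemma card_subtree (A : {set X}) u :
  #|A :&: T u| = ((u \in A) + \sum_(v | child u v) #|A :&: T v|)%N.
Proof.
have H v : #|A :&: T v| = (\sum_(x in T v) (x \in A))%N.
  rewrite -sum1_card big_mkcond [RHS]big_mkcond; apply: eq_bigr => x _.
  by rewrite inE andbC; case: (x \in T v) => //=; case: (x \in A).
rewrite H (sum_subtree rooted); congr (_ + _)%N.
by apply: eq_bigr => v _; rewrite H.
Qed.

(** At most [#|A :&: T u|] entries of a bundle are occupied, so [S] has at least
    [#|S| - #|A :&: T u|] vacant ones, and this difference is what the first [#|S|] slots of [u]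
    count. *)
Lemma profile_anti A : profile (anti A).
Proof.
move=> u S Su; rewrite /slotsum /anti /= -!natr_sum ler_nat.
set a := #|A :&: T u|.
have occ : (\sum_(e in S) ~~ vacant A e <= a)%N.
  apply: (@leq_trans (\sum_(e in bundle u) ~~ vacant A e)).
    rewrite [leqRHS](finset.big_setID S) /= (finset.setIidPr Su).
    exact: leq_addr.
  rewrite (sum_bundle (fun e => nat_of_bool (~~ vacant A e))) /= negbK.
  rewrite /a card_subtree leq_add2l; apply: leq_sum => v _.
  under eq_bigr do rewrite -ltnNge.
  rewrite (big_ord_lt _ _ (fun j => nat_of_bool (j < #|A :&: T v|)%N)) ?subsize_le//.
  by rewrite sum_nat_lt geq_minr.
have split_S : (\sum_(e in S) vacant A e + \sum_(e in S) ~~ vacant A e = #|S|)%N.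
  rewrite -big_split -sum1_card; apply: eq_bigr => e _ /=.
  by case: vacant.
have low : (\sum_(i < N | (i < #|S|)%N) (a <= i)%N <= #|S| - a)%N.
  rewrite (big_ord_lt _ _ (fun i => nat_of_bool (a <= i)%N)) ?sum_nat_ge//.
  by rewrite (leq_trans (card_sub_bundle Su)) ?subsize_le.
apply: leq_trans low _; rewrite leq_subLR -split_S addnC leq_add2r.
exact: occ.
Qed.

(** The shift on single points puts all of [bundle u], including [inr u], strictly deeper than the
    slots of [u]. *)
Definition level (e : E) : nat :=
  match e with inl (v, _) => dep v | inr u => (dep u).+1 end.

Lemma level_bundle u e : e \in bundle u -> (dep u < level e)%N.
Proof.
move=> /top_slot; case: e => [[v j]|z] /= => [[/andP[vr /eqP<-] _]|->//].
by case: rooted => _ ->.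
Qed.

(* Multipliers: [la u S] for the profile constraint of [S] at [u], [mu] for the
   floors, [f] for the request. A profile constraint pushes up the entries of
   [S], which lets mass out of them, and pulls down the slots of [u]. *)
Definition push (la : X -> {set E} -> R) (e : E) : R :=
  \sum_u \sum_(S : {set E}) la u S * (e \in S)%:R.

Definition pull (la : X -> {set E} -> R) (e : E) : R :=
  match e with
  | inl (v, i) => \sum_(S : {set E}) la v S * (i < #|S|)%:R
  | inr _ => 0
  end.

Definition drift la (mu : E -> R) (f : R) (r : X) (e : E) : R :=
  push la e - pull la e + mu e - f * (e == inr r)%:R.

(** The KKT system of the projection. All later arguments use feasibility, complementary slackness
    and the exponential update, never minimality. *)
Record projection (w x0 : E -> R) (r : X) (x : E -> R)
    (la : X -> {set E} -> R) (mu : E -> R) (f : R) : Prop := Projection {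
  proj_la0 : forall u S, 0 <= la u S;
  proj_la_sub : forall u S, 0 < la u S -> S \subset bundle u;
  proj_la_tight : forall u S, 0 < la u S -> \sum_(e in S) x e = slotsum x u #|S|;
  proj_mu0 : forall e, 0 <= mu e;
  proj_mu_own : forall u, mu (inr u) = 0;
  proj_mu_tight : forall p, 0 < mu (inl p) -> x (inl p) = slot_floor (inl p);
  proj_f0 : 0 <= f;
  proj_f_tight : 0 < f -> x (inr r) = 2 * delta;
  proj_profile : profile x;
  proj_floor : forall p, slot_floor (inl p) <= x (inl p);
  proj_request : x (inr r) <= 2 * delta;
  proj_update : forall e, x e = x0 e * expR (drift la mu f r e / w e)
}.

Let slotind (u : X) (s : nat) (e : E) : R :=
  if e is inl (v, i) then ((v == u) && (i < s)%N)%:R else 0.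

Let sum_slotind u s (z : E -> R) : \sum_e slotind u s e * z e = slotsum z u s.
Proof.
rewrite big_sumType /= [X in _ + X]big1 ?addr0; last by move=> i _; rewrite mul0r.
rewrite (eq_bigr (fun p : X * 'I_N => ((p.1 == u) && (p.2 < s)%N)%:R * z (inl (p.1, p.2)))).
  rewrite -(pair_bigA _ (fun v (i : 'I_N) => ((v == u) && (i < s)%N)%:R * z (inl (v, i)))).
  rewrite (bigD1 u)//= eqxx [X in _ + X]big1 ?addr0; last first.
    by move=> v /negbTE vu; rewrite big1// => i _; rewrite vu mul0r.
  rewrite /slotsum [RHS]big_mkcond; apply: eq_bigr => i _ /=.
  by case: ifP => _; rewrite ?mul1r ?mul0r.
by case.
Qed.

(** One server at [r], mixed with the floor, plus a term growing with the level: entries of a bundle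
    gain more than the slots above them, which makes the profile constraints strict. At [inr r] the
    level is [dep r + 1], so the gain is [dep r + 2] parts out of [dep r + 3] of [delta], and the
    value stays below [2 * delta]. *)
Let slater (r : X) (e : E) : R :=
  delta + (1 - delta) * anti [set r] e
  + (level e).+1%:R * (delta / (dep r + 3)%:R).

Let slater_profile r u (S : {set E}) : S \subset bundle u -> (0 < #|S|)%N ->
  slotsum (slater r) u #|S| < \sum_(e in S) slater r e.
Proof.
move=> Su S0; set eta := delta / (dep r + 3)%:R.
have eta0 : 0 < eta by rewrite divr_gt0 ?delta_gt0// ltr0n addn3.
have sN : (#|S| <= N)%N by rewrite (leq_trans (card_sub_bundle Su)) ?subsize_le.
have slot1 c : \sum_(i < N | (i < #|S|)%N) (c : R) = c * #|S|%:R.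
  by rewrite (big_ord_lt _ _ (fun=> c))// sumr_const card_ord mulr_natr.
have set1 c : \sum_(e in S) (c : R) = c * #|S|%:R by rewrite sumr_const mulr_natr.
have pa := profile_anti [set r] Su.
have slotE : slotsum (slater r) u #|S| = delta * #|S|%:R
    + (1 - delta) * slotsum (anti [set r]) u #|S| + (dep u).+1%:R * eta * #|S|%:R.
  by rewrite /slotsum /slater !big_split /= !slot1 -mulr_sumr.
have setE : \sum_(e in S) slater r e = delta * #|S|%:R
    + (1 - delta) * \sum_(e in S) anti [set r] e + \sum_(e in S) (level e).+1%:R * eta.
  by rewrite /slater !big_split /= set1 -mulr_sumr.
rewrite slotE setE; apply: ler_ltD.
  by rewrite lerD2l ler_wpM2l//; have := delta_le; lra.
apply: (@lt_le_trans _ _ (\sum_(e in S) (dep u).+2%:R * eta)).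
  by rewrite set1 ltr_pM2r ?ltr0n// ltr_pM2r// ltr_nat.
apply: ler_sum => e eS; rewrite ler_pM2r// ler_nat ltnS.
by apply: level_bundle; exact: (fintype.subsetP Su).
Qed.

Lemma projection_exists w x0 r : (0 < k)%N ->
  (forall e, 0 < w e) -> (forall e, 0 < x0 e) ->
  exists x la mu f, projection w x0 r x la mu f.
Proof.
move=> k0 w0 x00.
(* The empty set would give [0 <= 0], which no point satisfies strictly. Invalid indices carry the
   constraint [-1 <= 0] instead, which keeps the index type simple and the Slater condition true. *)
pose valid u (S : {set E}) := (S \subset bundle u) && (0 < #|S|)%N.
pose J : finType := ((X * {set E}) + (E + 'I_1))%type.
pose a (j : J) (e : E) : R :=
  match j with
  | inl (u, B) => (valid u B)%:R * ((e \in B)%:R - slotind u #|B| e)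
  | inr (inl (inl p)) => (e == inl p)%:R
  | inr (inl (inr _)) => 0
  | inr (inr _) => - (e == inr r)%:R
  end.
pose b (j : J) : R :=
  match j with
  | inl (u, B) => (valid u B)%:R - 1
  | inr (inl (inl p)) => slot_floor (inl p)
  | inr (inl (inr _)) => - 1
  | inr (inr _) => - (2 * delta)
  end.
have sum_pt (F : E -> R) e : \sum_e' (e' == e)%:R * F e' = F e.
  rewrite (bigD1 e)//= eqxx mul1r big1 ?addr0// => e' /negbTE ->.
  by rewrite mul0r.
have sum_a z u S : valid u S ->
    \sum_e a (inl (u, S)) e * z e = \sum_(e in S) z e - slotsum z u #|S|.
  move=> v; rewrite -sum_slotind [X in X - _]big_mkcond -sumrB.
  apply: eq_bigr => e _; rewrite /a v mul1r mulrBl; congr (_ - _).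
  by case: ifP => _; rewrite ?mul1r ?mul0r.
have d0 := delta_gt0; have d2 := delta_le.
have eta0 : 0 < delta / (dep r + 3)%:R by rewrite divr_gt0// ltr0n addn3.
have anti0 e : 0 <= anti [set r] e by rewrite /anti.
have y0 e : delta < slater r e.
  rewrite /slater -addrA ltrDl; apply: ltr_wpDl; last by rewrite mulr_gt0.
  by rewrite mulr_ge0// subr_ge0; lra.
have sl j : b j < \sum_e a j e * slater r e.
  case: j => [[u S]|[[p|u]|i]].
  - have [v|v] := boolP (valid u S); last first.
      by rewrite /= (negbTE v) big1 ?sub0r ?ltrN10// => e _; rewrite !mul0r.
    rewrite sum_a// /b v subrr subr_gt0.
    by case/andP: v => Su S0; exact: slater_profile.
  - rewrite /= sum_pt; have := y0 (inl p); case: p => v j /=.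
    case: ifP => // /andP[/eqP -> kj] _.
    have -> : slater r (inl (rho, j)) = 1 + (level (inl (rho, j))).+1%:R * (delta / (dep r + 3)%:R).
      have vj : vacant [set r] (inl (rho, j)).
        rewrite /= (leq_trans _ kj)//.
        by rewrite (leq_trans (subset_leq_card (finset.subsetIl _ _)))// cards1.
      have a1 : anti [set r] (inl (rho, j)) = 1 by rewrite /anti vj.
      by rewrite /slater a1 mulr1 addrCA subrr addr0.
    by rewrite ltrDl mulr_gt0.
  - by rewrite big1 ?ltrN10// => e _; rewrite mul0r.
  - rewrite /=; under eq_bigr do rewrite mulNr.
    rewrite sumrN sum_pt ltrN2 /slater /anti /= finset.inE eqxx mulr0 addr0.
    have e3 : (dep r + 3)%:R != 0 :> R by rewrite pnatr_eq0 addn3.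
    have -> : 2 * delta = delta + (dep r + 3)%:R * (delta / (dep r + 3)%:R).
      by rewrite mulrCA divff// mulr1; ring.
    by rewrite ltrD2l ltr_pM2r// ltr_nat addn3 !ltnS.
have y00 e : 0 < slater r e by exact: lt_trans (y0 e).
have [l [l0 +]] := entropic_kkt w0 x00 y00 sl.
pose x e := x0 e * expR ((\sum_j l j * a j e) / w e); rewrite -/x => le_b tight.
pose la u S := if valid u S then l (inl (u, S)) else 0.
pose mu (e : E) := if e is inl p then l (inr (inl e)) else 0.
pose f := l (inr (inr ord0)).
have tl e : \sum_j l j * a j e = drift la mu f r e.
  rewrite big_sumType /= [X in _ + X]big_sumType /= big_ord1 /drift addrA; congr (_ + _ + _).
  - rewrite (eq_bigr (fun p : X * {set E} => la p.1 p.2 * (e \in p.2)%:R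
        - la p.1 p.2 * slotind p.1 #|p.2| e)); last first.
      move=> [u S] _ /=; rewrite /la; case: ifP => _; last by rewrite !mul0r mulr0 subr0.
      by rewrite mul1r mulrBr.
    rewrite sumrB -(pair_bigA _ (fun u (S : {set E}) => la u S * (e \in S)%:R)).
    rewrite -(pair_bigA _ (fun u (S : {set E}) => la u S * slotind u #|S| e)).
    congr (_ - _).
    rewrite /pull /slotind; case: e => [[v i]|u]; last first.
      by rewrite big1// => u' _; rewrite big1// => S _; rewrite mulr0.
    rewrite (bigD1 v)//= [X in _ + X]big1 ?addr0; last first.
      move=> u uv; rewrite big1// => S _.
      by rewrite eq_sym (negbTE uv) mulr0.
    by apply: eq_bigr => S _; rewrite eqxx.
  - rewrite /mu; case: e => [p|u].
      rewrite (bigD1 (inl p))//= eqxx mulr1 big1 ?addr0// => -[q|u] qp; last by rewrite mulr0.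
      by rewrite eq_sym (negbTE qp) mulr0.
    by rewrite big1// => -[q|z] _; rewrite mulr0.
  - by rewrite mulrN.
exists x, la, mu, f; split.
- by move=> u S; rewrite /la; case: ifP.
- by move=> u S; rewrite /la; case: ifP => [/andP[]//|_]; rewrite ltxx.
- move=> u S; rewrite /la; case: ifP => [v lp|_]; last by rewrite ltxx.
  have := tight _ lp; rewrite sum_a// /b v subrr => /eqP.
  by rewrite subr_eq0 => /eqP.
- by case=> [p|u]; rewrite /mu.
- by [].
- by move=> p /tight; rewrite /a /b sum_pt.
- exact: l0.
- move=> /tight; rewrite /a /b; under eq_bigr do rewrite mulNr.
  by rewrite sumrN sum_pt => /oppr_inj.
- move=> u S Su; have [S0|S0] := posnP #|S|.
    rewrite S0 /slotsum big1 ?big1//.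
    by move=> e; rewrite (card0_eq S0).
  have v : valid u S by rewrite /valid Su.
  have := le_b (inl (u, S)).
  by rewrite sum_a// /b v subrr subr_ge0.
- by move=> p; have := le_b (inr (inl (inl p))); rewrite /a /b sum_pt.
- have := le_b (inr (inr ord0)); rewrite /a /b.
  under eq_bigr do rewrite mulNr.
  by rewrite sumrN sum_pt lerN2.
- by move=> e; rewrite /x tl.
Qed.

(** * The invariant and its preservation by a projection *)

Lemma slotsum0 x u : slotsum x u 0 = 0.
Proof. by rewrite /slotsum big1. Qed.

Lemma slotsumS x u (i : 'I_N) : slotsum x u i.+1 = slotsum x u i + x (inl (u, i)).
Proof.
rewrite /slotsum (bigD1 i)//= addrC; congr (_ + _); apply: eq_bigl => j.
by rewrite ltnS ltn_neqAle andbC.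
Qed.

(** With nondecreasing slots, [slotsum] is convex in the number of slots; this is the submodularity
    behind the uncrossing of tight sets. *)
Lemma slotsum_convex x u a b c : (a <= b)%N -> (b + c <= subsize u)%N ->
  (forall i i' : 'I_N, (i <= i')%N -> (i' < subsize u)%N ->
    x (inl (u, i)) <= x (inl (u, i'))) ->
  slotsum x u (a + c) + slotsum x u b <= slotsum x u (b + c) + slotsum x u a.
Proof.
move=> ab bc mono; elim: c bc => [|c IH] bc; first by rewrite !addn0 addrC.
rewrite !addnS in bc *.
have bN : (b + c < N)%N by exact: leq_trans bc (subsize_le u).
have aN : (a + c < N)%N by apply: leq_ltn_trans bN; rewrite leq_add2r.
rewrite (slotsumS x u (Ordinal bN)) (slotsumS x u (Ordinal aN)) /=.
have := IH (ltnW bc).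
have : x (inl (u, Ordinal aN)) <= x (inl (u, Ordinal bN)).
  by apply: mono => //=; rewrite leq_add2r.
lra.
Qed.

(** [inv_full] is conservation of mass between a vertex and its bundle; the projection imposes only
    one of the two inequalities. *)
Record admissible (x : E -> R) : Prop := Admissible {
  inv_slot : forall p, delta <= x (inl p);
  inv_own : forall u, 2 * delta <= x (inr u);
  inv_le1 : forall e, x e <= 1;
  inv_profile : profile x;
  inv_full : forall u, \sum_(e in bundle u) x e = slotsum x u (subsize u);
  inv_mono : forall u (i i' : 'I_N), (i <= i')%N -> (i' < subsize u)%N ->
    x (inl (u, i)) <= x (inl (u, i'));
  inv_root : forall j, x (inl (rho, j)) = slot_floor (inl (rho, j))
}.

Lemma floor_ge p : delta <= slot_floor (inl p).
Proof. by case: p => v j /=; case: ifP => // _; have := delta_le; lra. Qed.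

Lemma floor_le1 e : slot_floor e <= 1.
Proof.
case: e => [[v j]|u] //=.
by case: ifP => // _; have := delta_le; lra.
Qed.

Lemma inv_floor x : admissible x -> forall p, slot_floor (inl p) <= x (inl p).
Proof.
move=> I [v j]; have [->|vr] := eqVneq v rho; first by rewrite (inv_root I).
by rewrite /slot_floor (negbTE vr); exact: inv_slot I _.
Qed.

Lemma inv_gt0 x : admissible x -> forall e, 0 < x e.
Proof.
move=> I [p|u]; first by apply: lt_le_trans (inv_slot I p); exact: delta_gt0.
apply: lt_le_trans (inv_own I u); rewrite mulr_gt0//; exact: delta_gt0.
Qed.

Section one_step.
Variables (w x0 : E -> R) (r : X) (x : E -> R).
Variables (la : X -> {set E} -> R) (mu : E -> R) (f : R).
Hypothesis w0 : forall e, 0 < w e.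
Hypothesis I0 : admissible x0.
Hypothesis P : projection w x0 r x la mu f.
Local Notation dr := (drift la mu f r).

Let push0 e : 0 <= push la e.
Proof.
apply: sumr_ge0 => u _; apply: sumr_ge0 => S _.
by rewrite mulr_ge0// (proj_la0 P).
Qed.

Let pull0 e : 0 <= pull la e.
Proof.
case: e => [[v i]|u] //=; apply: sumr_ge0 => S _.
by rewrite mulr_ge0// (proj_la0 P).
Qed.

Let mu_case e : mu e = 0 \/ 0 < mu e.
Proof. by have := proj_mu0 P e; rewrite le_eqVlt => /orP[/eqP|]; [left|right]. Qed.

Let la_case u S : la u S = 0 \/ 0 < la u S.
Proof. by have := proj_la0 P u S; rewrite le_eqVlt => /orP[/eqP|]; [left|right]. Qed.

Let push_le0 e : (forall u S, 0 < la u S -> e \notin S) -> push la e = 0.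
Proof.
move=> H; rewrite /push big1// => u _; rewrite big1// => S _.
have [->|/H/negbTE->] := la_case u S.
  by rewrite mul0r.
by rewrite mulr0.
Qed.

Let push_gt0 e : 0 < push la e -> exists u S, 0 < la u S /\ e \in S.
Proof.
move=> p0; apply: contrapT => H; move: p0; rewrite push_le0 ?ltxx// => u S lS.
by apply/negP => eS; apply: H; exists u, S.
Qed.

Let decr e : dr e <= 0 -> x e <= x0 e.
Proof.
move=> d0; rewrite (proj_update P) ler_piMr ?(ltW (inv_gt0 I0 e))//.
by rewrite expR_le1 pmulr_lle0// invr_gt0.
Qed.

Let incr e : 0 <= dr e -> x0 e <= x e.
Proof.
move=> d0; rewrite (proj_update P) ler_peMr ?(ltW (inv_gt0 I0 e))//.
by rewrite -expR0 ler_expR divr_ge0// ltW.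
Qed.

Let x_gt0 e : 0 < x e.
Proof. by rewrite (proj_update P) mulr_gt0 ?expR_gt0 ?(inv_gt0 I0). Qed.

(** Dropping [e] from a tight set leaves a constraint with one slot fewer, so [e] is bounded by the
    last of the [#|S|] slots. *)
Let tight_le u (S : {set E}) e : 0 < la u S -> e \in S ->
  exists i : 'I_N, x e <= x (inl (u, i)).
Proof.
move=> lS eS; have Su := proj_la_sub P lS.
have S0 : (0 < #|S|)%N by rewrite card_gt0; apply/finset.set0Pn; exists e.
have iN : (#|S|.-1 < N)%N.
  by rewrite prednK// (leq_trans (card_sub_bundle Su))// subsize_le.
exists (Ordinal iN).
have := proj_la_tight P lS; rewrite (big_setD1 e eS) /=.
have cS : #|S :\ e| = #|S|.-1 by rewrite [in RHS](cardsD1 e) eS.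
have := @proj_profile _ _ _ _ _ _ _ P u (S :\ e).
rewrite (fintype.subset_trans (subD1set _ _) Su) => /(_ isT).
have := slotsumS x u (Ordinal iN); rewrite /= prednK// cS => ->.
lra.
Qed.

(** An entry above 1 must have risen, and floors are at most 1, so a profile multiplier raised it.
    It then lies in a tight set and is dominated by a slot of smaller level, to which induction
    applies. *)
Let x_le1 e : x e <= 1.
Proof.
have [m] := ubnP (level e); elim: m e => // m IH e em.
rewrite leNgt; apply/negP => x1.
have x0x : x0 e < x e by exact: le_lt_trans (inv_le1 I0 e) x1.
have d0 : 0 < dr e by rewrite ltNge; apply/negP => /decr; rewrite leNgt x0x.
have m0 : mu e = 0.
  have [//|] := mu_case e.
  case: e x1 {x0x d0 em} => [p|u] x1; last by rewrite (proj_mu_own P) ltxx.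
  by move=> /(proj_mu_tight P) xf; move: x1; rewrite xf ltNge floor_le1.
have p0 : 0 < push la e.
  apply: lt_le_trans d0 _; rewrite /drift m0 addr0.
  have := pull0 e; have : 0 <= f * (e == inr r)%:R by rewrite mulr_ge0// (proj_f0 P).
  lra.
have [u [S [lS eS]]] := push_gt0 p0.
have [i] := tight_le lS eS.
rewrite leNgt => /negP; apply; apply: le_lt_trans x1; apply: IH => /=.
by rewrite -ltnS (leq_trans _ em)// ltnS; apply: level_bundle;
  exact: (fintype.subsetP (proj_la_sub P lS)).
Qed.

Let x_own u : 2 * delta <= x (inr u).
Proof.
have [lt|le] := ltP 0 (f * (inr u == inr r :> E)%:R).
  have [ur|ur] := eqVneq (inr u : E) (inr r); last by rewrite (negbTE ur) mulr0 ltxx in lt.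
  by rewrite ur (proj_f_tight P)//; move: lt; rewrite ur eqxx mulr1.
apply: le_trans (inv_own I0 u) _; apply: incr.
rewrite /drift /pull (proj_mu_own P) subr0 addr0 subr_ge0.
exact: le_trans le (push0 _).
Qed.

(** No bundle contains a slot of the root, so only its floor multiplier can raise it. *)
Let x_root j : x (inl (rho, j)) = slot_floor (inl (rho, j)).
Proof.
apply/eqP; rewrite eq_le (proj_floor P) andbT.
have [m0|/(proj_mu_tight P)->//] := mu_case (inl (rho, j)).
rewrite -(inv_root I0); apply: decr.
rewrite /drift m0 mulr0 subr0 addr0 push_le0 ?sub0r ?oppr_le0//.
move=> u S lS; apply/negP => /(fintype.subsetP (proj_la_sub P lS)).
by rewrite inE /= eqxx.
Qed.

Hypothesis w_slot : forall v i i', w (inl (v, i)) = w (inl (v, i')).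

(** If the order were reversed, exchanging [i] for [i'] in a tight set would violate the profile
    constraint. So each tight set with a positive multiplier that contains [i] contains [i']; the
    drift at [i'] is then at least that at [i], and with equal weights the update preserves the old
    order. *)
Let x_mono u (i i' : 'I_N) : (i <= i')%N -> (i' < subsize u)%N ->
  x (inl (u, i)) <= x (inl (u, i')).
Proof.
move=> ii' i'u; have [ur|ur] := eqVneq u rho.
  rewrite ur !x_root /slot_floor eqxx /=.
  case: ifP => ki; case: ifP => ki'; rewrite ?lexx//; last by have := delta_le; lra.
  by rewrite (leq_trans ki ii') in ki'.
rewrite leNgt; apply/negP => lt.
have m0 : mu (inl (u, i)) = 0.
  have [//|] := mu_case (inl (u, i)).
  move=> /(proj_mu_tight P); rewrite /slot_floor (negbTE ur) => xd.
  by move: lt; rewrite xd ltNge (le_trans _ (proj_floor P _)) ?floor_ge.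
have pp : push la (inl (u, i)) <= push la (inl (u, i')).
  apply: ler_sum => u' _; apply: ler_sum => S _.
  have [->|lS] := la_case u' S; first by rewrite !mul0r.
  rewrite ler_pM2l// ler_nat.
  have [eS|//] := boolP (inl (u, i) \in S).
  have [//|eS'] := boolP (inl (u, i') \in S).
  have Su := proj_la_sub P lS.
  have eb : inl (u, i') \in bundle u'.
    have := fintype.subsetP Su _ eS; rewrite !inE /= ur i'u.
    by rewrite (leq_ltn_trans ii' i'u).
  pose S' : {set E} := inl (u, i') |: (S :\ inl (u, i)).
  have e'S : inl (u, i') \notin S :\ inl (u, i) by rewrite finset.inE negb_and eS' orbT.
  have cS : #|S'| = #|S| by rewrite cardsU1 e'S [in RHS](cardsD1 (inl (u, i))) eS.
  have S'u : S' \subset bundle u'.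
    apply/fintype.subsetP => e; rewrite !in_setU1 => /orP[/eqP->//|].
    by rewrite in_setD1 => /andP[_]; exact: (fintype.subsetP Su).
  have := proj_profile P S'u; rewrite cS -(proj_la_tight P lS).
  rewrite (big_setU1 _ e'S) /= (big_setD1 _ eS) /= lerD2r.
  by rewrite leNgt lt.
have qq : pull la (inl (u, i')) <= pull la (inl (u, i)).
  apply: ler_sum => S _; rewrite ler_wpM2l ?(proj_la0 P)// ler_nat.
  by case: ltnP => // /(leq_ltn_trans ii') ->.
have dd : dr (inl (u, i)) <= dr (inl (u, i')).
  have z p : f * (inl p == inr r :> E)%:R = 0 by rewrite mulr0.
  by rewrite /drift !z m0; have := proj_mu0 P (inl (u, i')); lra.
move: lt; rewrite ltNge => /negP; apply.
rewrite !(proj_update P) (w_slot u i i').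
apply: ler_pM; rewrite ?expR_ge0 ?(ltW (inv_gt0 I0 _))//.
  exact: (inv_mono I0).
by rewrite ler_expR ler_pM2r// invr_gt0.
Qed.

Let tight u (S : {set E}) :=
  (S \subset bundle u) && (\sum_(e in S) x e == slotsum x u #|S|).

(** Uncrossing: entry sums are modular, while the slot sums are convex in the cardinality. *)
Let tightU u A B : tight u A -> tight u B -> tight u (A :|: B).
Proof.
move=> /andP[Au /eqP At] /andP[Bu /eqP Bt].
have Uu : A :|: B \subset bundle u by rewrite finset.subUset Au.
rewrite /tight Uu eq_le (proj_profile P Uu) andbT.
have Iu : A :&: B \subset bundle u by exact: fintype.subset_trans (finset.subsetIl _ _) Au.
have lowI := proj_profile P Iu.
have UI : \sum_(e in A :|: B) x e + \sum_(e in A :&: B) x e =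
    \sum_(e in A) x e + \sum_(e in B) x e.
  rewrite (finset.big_setID A) /= [X in _ = _ + X](finset.big_setID A) /=.
  rewrite finset.setUK finset.setDUl finset.setDv finset.set0U [B :&: A]finset.setIC; ring.
have := @slotsum_convex x u #|A :&: B| #|A| #|B :\: A|.
have cU : (#|A| + #|B :\: A| = #|A :|: B|)%N.
  by have := cardsUI A B; have := cardsID A B; rewrite finset.setIC; lia.
have cB : (#|A :&: B| + #|B :\: A| = #|B|)%N by rewrite finset.setIC cardsID.
rewrite cU cB => /(_ (subset_leq_card (finset.subsetIl _ _)) (card_sub_bundle Uu) (x_mono (u := u))).
lra.
Qed.

Let slotsum_tail z u s s' : (s <= s')%N ->
  slotsum z u s' = slotsum z u s + \sum_(i < N | (s <= i < s')%N) z (inl (u, i)).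
Proof.
move=> ss; rewrite /slotsum (bigID (fun i : 'I_N => (i < s)%N)) /=; congr (_ + _).
  by apply: eq_bigl => i; rewrite andbC; case: ltnP => //= /leq_trans ->.
by apply: eq_bigl => i; rewrite andbC -leqNgt.
Qed.

(* No mass stays behind inside the tree: outside a largest tight set only
   the parent's slots are pushed up, so the slack of the whole bundle cannot grow. *)
Let x_full u : \sum_(e in bundle u) x e = slotsum x u (subsize u).
Proof.
have t0 : tight u finset.set0.
  by rewrite /tight finset.sub0set big_set0 cards0 slotsum0 eqxx.
case: (@arg_maxnP _ finset.set0 (tight u) (fun S : {set E} => #|S|) t0) => B tB Bmax.
have maxB S : 0 < la u S -> S \subset B.
  move=> lS; have tS : tight u S by rewrite /tight (proj_la_sub P lS) (proj_la_tight P lS) eqxx.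
  have := Bmax _ (tightU tB tS) => le.
  have /eqP -> : B == B :|: S by rewrite eqEcard finset.subsetUl.
  exact: finset.subsetUr.
have [Bu /eqP Bt] := andP tB.
have down e : e \in bundle u :\: B -> x e <= x0 e.
  rewrite finset.inE => /andP[eB eu].
  have p0 : push la e = 0.
    apply: push_le0 => u' S lS; apply/negP => eS.
    have := fintype.subsetP (proj_la_sub P lS) _ eS; rewrite inE => /eqP te.
    move: eu; rewrite inE te => /eqP[uu]; rewrite uu in lS.
    by move: eB; rewrite (fintype.subsetP (maxB _ lS) _ eS).
  have [m0|] := mu_case e.
    apply: decr; rewrite /drift p0 m0 addr0 sub0r.
    have := pull0 e; have : 0 <= f * (e == inr r)%:R by rewrite mulr_ge0// (proj_f0 P).
    lra.
  case: e {eB eu p0} => [p|z]; last by rewrite (proj_mu_own P) ltxx.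
  by move=> /(proj_mu_tight P) ->; exact: inv_floor.
have up (i : 'I_N) : (#|B| <= i)%N -> x0 (inl (u, i)) <= x (inl (u, i)).
  move=> Bi; apply: incr; rewrite /drift /= mulr0 subr0.
  rewrite [X in _ - X]big1 ?subr0 ?addr_ge0 ?push0 ?(proj_mu0 P)// => S _.
  have [->|/maxB/subset_leq_card SB] := la_case u S.
    by rewrite mul0r.
  by rewrite ltnNge (leq_trans SB Bi) mulr0.
apply/eqP; rewrite eq_le; apply/andP; split; last first.
  by have := proj_profile P (subxx (bundle u)); rewrite card_bundle.
have Bn := card_sub_bundle Bu.
have split_bundle z : \sum_(e in bundle u) z e =
    \sum_(e in B) z e + \sum_(e in bundle u :\: B) (z e : R).
  by rewrite (finset.big_setID B) /= (finset.setIidPr Bu).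
have E0 := inv_full I0 u; rewrite split_bundle in E0.
have L0 := inv_profile I0 Bu.
rewrite split_bundle Bt (slotsum_tail _ _ Bn) lerD2l.
rewrite (slotsum_tail _ _ Bn) in E0.
have : \sum_(e in bundle u :\: B) x e <= \sum_(e in bundle u :\: B) x0 e.
  by apply: ler_sum => e /down.
have : \sum_(i < N | (#|B| <= i < subsize u)%N) x0 (inl (u, i)) <=
   \sum_(i < N | (#|B| <= i < subsize u)%N) x (inl (u, i)).
  by apply: ler_sum => i /andP[/up].
lra.
Qed.

Lemma projection_invariant : admissible x.
Proof.
split=> // [p|]; last exact: (proj_profile P).
exact: le_trans (floor_ge p) (proj_floor P p).
Qed.

(** * Cost of one projection *)

Variable D : nat.
Hypothesis depD : forall v, (dep v <= D)%N.

(** Test weights for the telescoping: entries of [bundle u] have height at most [D - dep u] and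
    slots of [u] have [D.+1 - dep u]. Pairing the drift with [height * x] therefore leaves every
    flux with coefficient at most -1. *)
Definition height (e : E) : R :=
  match e with inl (v, _) => (D.+1 - dep v)%:R | inr _ => 0 end.

Let sum_push z : \sum_e push la e * z e = \sum_u \sum_(S : {set E}) la u S * \sum_(e in S) z e.
Proof.
rewrite /push; under eq_bigr do rewrite mulr_suml.
rewrite exchange_big; apply: eq_bigr => u _ /=.
under eq_bigr do rewrite mulr_suml.
rewrite exchange_big; apply: eq_bigr => S _ /=.
under eq_bigr do rewrite -mulrA.
rewrite -mulr_sumr [in RHS]big_mkcond; congr (_ * _); apply: eq_bigr => e _.
by case: (e \in S); rewrite ?mul1r ?mul0r.
Qed.

Let sum_pull z : \sum_e pull la e * z e = \sum_u \sum_(S : {set E}) la u S * slotsum z u #|S|.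
Proof.
rewrite big_sumType /= [X in _ + X]big1 ?addr0; last by move=> i _; rewrite mul0r.
rewrite (eq_bigr (fun p : X * 'I_N =>
  (\sum_(S : {set E}) la p.1 S * (p.2 < #|S|)%:R) * z (inl (p.1, p.2)))); last by case.
rewrite -(pair_bigA _ (fun v (i : 'I_N) =>
  (\sum_(S : {set E}) la v S * (i < #|S|)%:R) * z (inl (v, i)))).
apply: eq_bigr => u _ /=.
under eq_bigr do rewrite mulr_suml.
rewrite exchange_big; apply: eq_bigr => S _ /=.
under eq_bigr do rewrite -mulrA.
rewrite -mulr_sumr /slotsum [in RHS]big_mkcond; congr (_ * _); apply: eq_bigr => i _.
by case: (i < #|S|)%N; rewrite ?mul1r ?mul0r.
Qed.

(** By tightness this is both what the multipliers of [u] push on its bundle and what they pull on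
    its slots. *)
Let flux u := \sum_(S : {set E}) la u S * \sum_(e in S) x e.

Let flux_slot u : \sum_(S : {set E}) la u S * slotsum x u #|S| = flux u.
Proof.
apply: eq_bigr => S _; have [->|/(proj_la_tight P)->//] := la_case u S.
by rewrite !mul0r.
Qed.

Let sum_request (z : E -> R) : \sum_e f * (e == inr r)%:R * z e = f * z (inr r).
Proof.
rewrite (bigD1 (inr r))//= eqxx mulr1 big1 ?addr0// => e /negbTE ->.
by rewrite mulr0 mul0r.
Qed.

Let sum_drift z : \sum_e dr e * z e =
  \sum_e push la e * z e - \sum_e pull la e * z e + \sum_e mu e * z e - f * z (inr r).
Proof.
rewrite -sum_request /drift -sumrB -big_split -sumrB /=; apply: eq_bigr => e _.
ring.
Qed.

(** Linearizes the update at the new point, by [1 + s <= expR s] with [s = - (dr e / w e)].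
    Complementary slackness holds at the new point, so the right side can be summed exactly. *)
Let moved e : w e * (x e - x0 e) <= dr e * x e.
Proof.
have h := expR_ge1Dx (- (dr e / w e)).
have x0E : x0 e = x e * expR (- (dr e / w e)).
  by rewrite (proj_update P) -mulrA -expRD subrr expR0 mulr1.
have : w e * (x e * (1 - dr e / w e)) <= w e * (x e * expR (- (dr e / w e))).
  by rewrite ler_pM2l// ler_pM2l.
rewrite -x0E.
have -> : w e * (x e * (1 - dr e / w e)) = w e * x e - dr e * x e.
  by field; rewrite gt_eqF.
lra.
Qed.

Let M := \sum_e mu e * x e.
Let request_mass : f * x (inr r) = f * (2 * delta).
Proof.
have := proj_f0 P; rewrite le_eqVlt => /orP[/eqP<-|/(proj_f_tight P)->//].
by rewrite !mul0r.
Qed.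

Let flux_le : \sum_u flux u <= D.+1%:R * M - \sum_e height e * (w e * (x e - x0 e)).
Proof.
have h0 e : 0 <= height e by case: e => [[v j]|u] /=.
have hD e : height e <= D.+1%:R.
  by case: e => [[v j]|u] //=; rewrite ler_nat leq_subr.
have : \sum_e height e * (w e * (x e - x0 e)) <= \sum_e dr e * (height e * x e).
  by apply: ler_sum => e _; rewrite [leRHS]mulrCA ler_wpM2l// moved.
rewrite sum_drift sum_push sum_pull /= mul0r mulr0 subr0.
have : \sum_u \sum_(S : {set E}) la u S * (\sum_(e in S) height e * x e)
   <= \sum_u (D - dep u)%:R * flux u.
  apply: ler_sum => u _; rewrite /flux mulr_sumr; apply: ler_sum => S _.
  have [->|lS] := la_case u S; first by rewrite !mul0r mulr0.
  rewrite mulrCA ler_pM2l// mulr_sumr; apply: ler_sum => e eS.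
  rewrite ler_pM2r//.
  have := level_bundle (fintype.subsetP (proj_la_sub P lS) _ eS).
  case: e {eS} => [[v j]|z] /= lv; last by [].
  by rewrite ler_nat; lia.
have -> : \sum_u \sum_(S : {set E}) la u S * slotsum (fun e => height e * x e) u #|S|
   = \sum_u (D.+1 - dep u)%:R * flux u.
  apply: eq_bigr => u _; rewrite -flux_slot mulr_sumr; apply: eq_bigr => S _.
  by rewrite mulrCA; congr (_ * _); rewrite /slotsum mulr_sumr.
have : \sum_e mu e * (height e * x e) <= D.+1%:R * M.
  rewrite /M mulr_sumr; apply: ler_sum => e _; rewrite mulrCA ler_wpM2r//.
  by rewrite mulr_ge0 ?(proj_mu0 P)// ltW.
have : \sum_u flux u + \sum_u (D - dep u)%:R * flux u = \sum_u (D.+1 - dep u)%:R * flux u.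
  rewrite -big_split; apply: eq_bigr => u _ /=.
  by rewrite subSn// -natr1 mulrDl mul1r addrC.
lra.
Qed.

(* Here the extra half server is used: the request constraint is tight at
   [2 * delta] whereas [y (inr r) <= delta], so that the loss [f * delta] at the
   request is at most half of the gain [M] from the floors. *)
Lemma projection_cost (y : E -> R) : profile y -> (forall e, 0 <= y e) ->
  (forall p, slot_floor (inl p) <= y (inl p)) -> y (inr r) <= delta ->
  \sum_e w e * `|x e - x0 e| <=
    4 * D.+2%:R * (\sum_e w e * y e * (ln (x e) - ln (x0 e)))
    + \sum_e (2 * D.+2%:R + 2 * height e + 1) * (w e * (x0 e - x e)).
Proof.
move=> py y0 yf yr.
set G := \sum_e w e * y e * _.
have GE : G = \sum_e dr e * y e.
  apply: eq_bigr => e _; rewrite (proj_update P) lnM ?posrE ?expR_gt0 ?(inv_gt0 I0)//.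
  by rewrite expRK; field; rewrite gt_eqF.
pose tel := \sum_e w e * (x e - x0 e).
pose telh := \sum_e height e * (w e * (x e - x0 e)).
have potential : M - f * delta <= G.
  rewrite GE sum_drift sum_push sum_pull.
  have : \sum_u \sum_(S : {set E}) la u S * slotsum y u #|S| <=
      \sum_u \sum_(S : {set E}) la u S * \sum_(e in S) y e.
    apply: ler_sum => u _; apply: ler_sum => S _.
    have [->|lS] := la_case u S; first by rewrite !mul0r.
    by rewrite ler_pM2l//; apply: py; exact: proj_la_sub P _ _ lS.
  have : M <= \sum_e mu e * y e.
    apply: ler_sum => -[p|u] _; last by rewrite (proj_mu_own P) !mul0r.
    have [->|lp] := mu_case (inl p); first by rewrite !mul0r.
    by rewrite ler_pM2l// (proj_mu_tight P lp).
  have : f * y (inr r) <= f * delta by exact: ler_wpM2l (proj_f0 P) _ _ yr.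
  lra.
have sum_f : 2 * (f * delta) <= M - tel.
  have : tel <= \sum_e dr e * x e by apply: ler_sum => e _; exact: moved.
  rewrite sum_drift sum_push sum_pull request_mass.
  have -> : \sum_u \sum_(S : {set E}) la u S * slotsum x u #|S| = \sum_u flux u.
    by apply: eq_bigr => u _; exact: flux_slot.
  rewrite -/M /flux; lra.
(* An absolute value is twice the positive part minus the value. Only increases of anti-mass are
   charged, and only [push] and [mu] cause them. *)
have moves : \sum_e w e * `|x e - x0 e| <= 2 * (\sum_u flux u + M) - tel.
  have -> : \sum_u flux u = \sum_e push la e * x e by rewrite sum_push.
  rewrite /M /tel -big_split /= mulr_sumr -sumrB; apply: ler_sum => e _.
  have pm : 0 <= push la e * x e + mu e * x e.
    by rewrite addr_ge0// mulr_ge0 ?push0 ?(proj_mu0 P)// ltW.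
  have [le|lt] := leP (x0 e) (x e).
    have -> : `|x e - x0 e| = x e - x0 e by rewrite ger0_norm// subr_ge0.
    have := moved e; rewrite /drift !mulrDl !mulNr.
    have : 0 <= pull la e * x e by rewrite mulr_ge0 ?pull0// ltW.
    have : 0 <= f * (e == inr r)%:R * x e.
      by rewrite mulr_ge0 ?mulr_ge0 ?(proj_f0 P)// ltW.
    lra.
  have -> : `|x e - x0 e| = - (x e - x0 e) by rewrite ltr0_norm// subr_lt0.
  have : 0 <= 2 * (push la e * x e + mu e * x e) by rewrite mulr_ge0.
  by rewrite mulrN; lra.
have flu := flux_le; rewrite -/telh in flu.
have -> : \sum_e (2 * D.+2%:R + 2 * height e + 1) * (w e * (x0 e - x e)) =
    - (2 * D.+2%:R + 1) * tel - 2 * telh.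
  rewrite /tel /telh !mulr_sumr -sumrB; apply: eq_bigr => e _; ring.
have D2 : D.+2%:R = D.+1%:R + 1 :> R by rewrite natr1.
have D0 : 0 <= D.+1%:R :> R by [].
(* Eliminating [f * delta] costs the factor 2 here; the movement bound has coefficient [2 * D.+2] on
   [M], hence [4 * D.+2] on [G]. *)
have M2 : M <= 2 * G - tel by lra.
have : D.+2%:R * M <= D.+2%:R * (2 * G - tel) by apply: ler_wpM2l.
rewrite D2; lra.
Qed.

End one_step.

(** * From profiles to fractional solutions *)

Lemma subsize_root : subsize rho = N.
Proof. by apply: eq_card => x; rewrite (subtree_root rooted). Qed.

Definition mass_of (x : E -> R) (u : X) : R := (1 - x (inr u)) / (1 - 2 * delta).

Hypothesis k0 : (0 < k)%N.
Hypothesis kN : (k < N)%N.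

Lemma denom_gt0 : 0 < 1 - 2 * delta.
Proof.
have := delta_eq; have := delta_gt0; have : 1 <= k%:R :> R by rewrite ler1n.
nra.
Qed.

Lemma inv_denom_le2 : (1 - 2 * delta)^-1 <= 2.
Proof.
rewrite -[leLHS]mul1r ler_pdivrMr ?denom_gt0//.
have := delta_eq; have := delta_gt0; have : 1 <= k%:R :> R by rewrite ler1n.
nra.
Qed.

(** Conservation at every vertex telescopes down the tree; thus the mass below an edge is visible in
    the slots of its lower end. *)
Lemma subtree_own_mass x v : admissible x ->
  \sum_(u in T v) (1 - x (inr u)) = \sum_(j < N | (j < subsize v)%N) (1 - x (inl (v, j))).
Proof.
move=> I; have [m] := ubnP (subsize v); elim: m v => // m IH v vm.
rewrite (sum_subtree rooted).
have -> : \sum_(z | child v z) \sum_(u in T z) (1 - x (inr u)) =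
    \sum_(z | child v z) \sum_(j < N | (j < subsize z)%N) (1 - x (inl (z, j))).
  apply: eq_bigr => z cz; apply: IH; apply: leq_trans (_ : subsize v <= m)%N => //.
  apply: proper_card; apply/properP; split.
    by apply/fintype.subsetP => u /(child_subtree rooted cz)/andP[].
  exists v; first exact: subtree_refl.
  by apply/negP => /(child_subtree rooted cz); rewrite eqxx andbF.
rewrite -(sum_bundle (fun e => 1 - x e)) sumrB (inv_full I) sumrB; congr (_ - _).
by rewrite (big_ord_lt _ _ (fun=> 1 : R)) ?subsize_le// !sumr_const card_bundle card_ord.
Qed.

Lemma mass_in_of x v : admissible x ->
  mass_in par (mass_of x) v =
  (\sum_(j < N | (j < subsize v)%N) (1 - x (inl (v, j)))) / (1 - 2 * delta).
Proof. by move=> I; rewrite /mass_in /mass_of -mulr_suml subtree_own_mass. Qed.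

Lemma floor_sum s : (s <= N)%N ->
  \sum_(i < N | (i < s)%N) slot_floor (inl (rho, i)) =
  delta * s%:R + (1 - delta) * (s - k)%N%:R.
Proof.
move=> sN; have fE (i : 'I_N) : slot_floor (inl (rho, i)) = delta + (1 - delta) * (k <= i)%:R.
  by rewrite /= eqxx /=; case: ifP => _; rewrite ?mulr1 ?mulr0 ?addr0// addrCA subrr addr0.
under eq_bigr do rewrite fE.
rewrite (big_ord_lt _ _ (fun i : nat => delta + (1 - delta) * (k <= i)%:R))// big_split /=.
by rewrite sumr_const card_ord mulr_natr -mulr_sumr -natr_sum sum_nat_ge.
Qed.

Lemma mass_of_total x : admissible x -> \sum_u mass_of x u = k%:R + 2^-1.
Proof.
move=> I; rewrite -(mass_in_root rooted) mass_in_of// subsize_root.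
rewrite sumrB (big_ord_lt _ _ (fun=> 1 : R))// sumr_const card_ord.
under eq_bigr do rewrite (inv_root I).
rewrite floor_sum// natrB ?(ltnW kN)//.
have d0 := denom_gt0; have := delta_eq.
set d := delta in d0 *; move=> dE.
apply: (mulIf (lt0r_neq0 d0)); rewrite divfK ?lt0r_neq0//.
have : N%:R - (d * N%:R + (1 - d) * (N%:R - k%:R)) = k%:R * (1 - d) by ring.
move=> ->; nra.
Qed.

Lemma mass_of_ge0 x u : admissible x -> 0 <= mass_of x u.
Proof.
by move=> I; rewrite divr_ge0 ?(ltW denom_gt0)// subr_ge0 (inv_le1 I).
Qed.

Lemma mass_of_request w x0 r x la mu f : admissible x ->
  projection w x0 r x la mu f -> mass_of x r = 1.
Proof.
move=> I P; rewrite /mass_of.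
have -> : x (inr r) = 2 * delta by apply/eqP; rewrite eq_le (proj_request P) (inv_own I).
by rewrite divff// lt0r_neq0// denom_gt0.
Qed.

(** Spreads the root capacity [k * (1 - delta)] evenly: every point holds
    [1 - beta = (1 - delta) * k / N]. *)
Definition initial (e : E) : R :=
  let beta := delta + (1 - delta) * ((N - k)%N%:R / N%:R) in
  match e with
  | inl (v, j) => if v == rho then slot_floor e else beta
  | inr _ => beta
  end.

Lemma initial_invariant : admissible initial.
Proof.
set beta := delta + (1 - delta) * ((N - k)%N%:R / N%:R).
have N0 : 0 < N%:R :> R by rewrite ltr0n (ltn_trans k0 kN).
have d0 := delta_gt0; have d2 := delta_le; have dE := delta_eq.
have NkE : (N - k)%N%:R = N%:R - k%:R :> R by rewrite natrB// ltnW.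
have qE : (N - k)%N%:R / N%:R * N%:R = N%:R - k%:R :> R by rewrite divfK ?lt0r_neq0.
set q := _ / N%:R in beta qE.
have kR : 1 <= k%:R :> R by rewrite ler1n.
have kNR : k%:R + 1 <= N%:R :> R by rewrite natr1 ler_nat.
have q0 : 0 <= q by rewrite divr_ge0.
have q1 : q <= 1.
  by rewrite -(ler_pM2r N0) qE; lra.
(* The worst case is [N = k + 1]; the bound says that [q] is at least [2 * delta], whence
   [2 * delta <= beta]. *)
have qk : 1 <= q * (k%:R + 1).
  rewrite -(ler_pM2r N0) mulrAC qE; nra.
have beta1 : beta <= 1 by rewrite /beta; nra.
have beta2 : 2 * delta <= beta.
  rewrite /beta; suff : delta <= (1 - delta) * q by lra.
  have h : 0 < k%:R + 1 :> R by lra.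
  rewrite -(ler_pM2r h) -[leRHS]mulrA.
  have : (1 - delta) * 1 <= (1 - delta) * (q * (k%:R + 1)) by rewrite ler_wpM2l//; lra.
  nra.
have prof u s : (s <= N)%N -> slotsum initial u s <= beta * s%:R.
  move=> sN; rewrite /slotsum /= -/q -/beta; have [ur|ur] := eqVneq u rho; last first.
    by rewrite (big_ord_lt _ _ (fun=> beta : R))// sumr_const card_ord mulr_natr.
  rewrite (eq_bigr (fun i : 'I_N => slot_floor (inl (rho, i)))); last first.
    by move=> i _; rewrite /= ?ur eqxx.
  rewrite floor_sum// /beta [leRHS]mulrDl lerD2l -[leRHS]mulrA ler_wpM2l//; first by lra.
  have [sk|ks] := leqP s k.
    have -> : (s - k = 0)%N by apply/eqP; rewrite subn_eq0.
    by rewrite mulr_ge0.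
  rewrite natrB ?(ltnW ks)// -(ler_pM2r N0) mulrAC qE.
  have : s%:R <= N%:R :> R by rewrite ler_nat.
  nra.
have bundleE u (S : {set E}) : S \subset bundle u ->
    \sum_(e in S) initial e = beta * #|S|%:R.
  move=> Su; rewrite mulr_natr -sumr_const; apply: eq_bigr => e eS.
  have := top_slot (fintype.subsetP Su _ eS).
  by case: e {eS} => [[v j]|z] //= [/andP[/negbTE ->]].
split.
- move=> [v j]; rewrite /initial -/q -/beta; case: ifP => _; last by lra.
  exact: floor_ge.
- by [].
- move=> [[v j]|u]; rewrite /initial -/q -/beta//; case: ifP => _ //.
  exact: floor_le1.
- move=> u S Su; rewrite (bundleE _ _ Su); apply: prof.
  by rewrite (leq_trans (card_sub_bundle Su)) ?subsize_le.
- move=> u; rewrite (bundleE u _ (subxx _)) card_bundle.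
  rewrite /slotsum /= -/q -/beta; have [ur|ur] := eqVneq u rho; last first.
    by rewrite (big_ord_lt _ _ (fun=> beta : R)) ?subsize_le// sumr_const card_ord mulr_natr.
  rewrite (eq_bigr (fun i : 'I_N => slot_floor (inl (rho, i)))); last first.
    by move=> i _; rewrite /= ?ur eqxx.
  rewrite ur subsize_root floor_sum// /beta NkE [LHS]mulrDl -[in LHS]mulrA qE.
  by [].
- move=> u i i' ii' _; rewrite /initial -/q -/beta; case: eqP => // ->.
  rewrite /slot_floor eqxx /=; case: ifP => ki; case: ifP => ki'; rewrite ?lexx//; last by lra.
  by rewrite (leq_trans ki ii') in ki'.
- by move=> j; rewrite /initial eqxx.
Qed.

(** * The offline profile, and movement of profiles against movement of mass *)

Definition target (A : {set X}) (e : E) : R := delta + (1 - delta) * anti A e.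

Lemma target_profile A : profile (target A).
Proof.
move=> u S Su; have := profile_anti A Su.
rewrite /slotsum /target !big_split /= -!mulr_sumr.
rewrite (big_ord_lt _ _ (fun=> delta)) ?(leq_trans (card_sub_bundle Su)) ?subsize_le//.
rewrite !sumr_const card_ord lerD2l => h; apply: ler_wpM2l h.
have := delta_le; lra.
Qed.

Lemma target_ge A e : delta <= target A e.
Proof.
rewrite lerDl mulr_ge0 ?/anti//; have := delta_le; lra.
Qed.

Lemma target_le1 A e : target A e <= 1.
Proof.
have := delta_le; have := delta_gt0.
by rewrite /target /anti; case: vacant; rewrite ?mulr1 ?mulr0 => ? ?; lra.
Qed.

Lemma target_floor (A : {set X}) p : #|A| = k -> slot_floor (inl p) <= target A (inl p).
Proof.
case: p => v j Ak; rewrite {1}/slot_floor; case: ifP => [/andP[/eqP -> kj]|_]; last exact: target_ge.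
rewrite /target /anti.
have -> : vacant A (inl (rho, j)).
  by rewrite /= (leq_trans _ kj)// -Ak subset_leq_card// finset.subsetIl.
by rewrite mulr1 addrCA subrr addr0.
Qed.

Lemma target_served (A : {set X}) r : r \in A -> target A (inr r) <= delta.
Proof. by move=> rA; rewrite /target /anti /= rA mulr0 addr0. Qed.

Lemma sum_dist_le n a b : \sum_(j < n) `|(a <= j)%N%:R - (b <= j)%N%:R| <= `|a%:R - b%:R| :> R.
Proof.
wlog ab : a b / (a <= b)%N.
  move=> H; have [/H//|/ltnW/H] := leqP a b.
  by rewrite distrC; under eq_bigr do rewrite distrC.
have -> : \sum_(j < n) `|(a <= j)%N%:R - (b <= j)%N%:R| = \sum_(j < n) ((a <= j)%N%:R - (b <= j)%N%:R) :> R.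
  apply: eq_bigr => j _; rewrite ger0_norm// subr_ge0 ler_nat.
  by case: (leqP b j) => // /(leq_trans ab) ->.
rewrite sumrB -!natr_sum !sum_nat_ge distrC ger0_norm ?subr_ge0 ?ler_nat//.
by rewrite -!natrB ?leq_sub2l// ler_nat; lia.
Qed.

Lemma mass_in_set (A : {set X}) v : mass_in par (set_mass R A) v = #|A :&: T v|%:R.
Proof.
rewrite -sum1_card natr_sum /mass_in /set_mass big_mkcond [RHS]big_mkcond; apply: eq_bigr => x _.
by rewrite finset.in_setI andbC; case: (x \in T v) => //=; case: (x \in A).
Qed.

Definition weight (len : X -> X -> R) (eps : R) (e : E) : R :=
  match e with
  | inl (v, _) => (if v == rho then 0 else len v (par v)) + eps
  | inr _ => eps
  end.

(** If the number of servers below an edge changes by [m], at most [m] slots flip, which reproduces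
    the cut distance; single points and root slots cost only [eps]. *)
Lemma target_move len eps A B : 0 <= eps -> (forall v, v != rho -> 0 <= len v (par v)) ->
  \sum_e weight len eps e * `|target A e - target B e| <=
    cut_dist rho par len (set_mass R A) (set_mass R B) + eps * #|E|%:R.
Proof.
move=> eps0 len0.
have tE e : `|target A e - target B e| <= `|anti A e - anti B e|.
  rewrite /target opprD addrACA subrr add0r -mulrBr normrM ler_piMl//.
  by have d2 := delta_le; have d0 := delta_gt0; rewrite ger0_norm; lra.
have aE e : `|anti A e - anti B e| <= 1.
  by rewrite /anti; case: vacant; case: vacant;
    rewrite ?subrr ?subr0 ?sub0r ?normrN ?normr0 ?normr1.
pose base (e : E) : R := if e is inl (v, _) then (if v == rho then 0 else len v (par v)) else 0.
have base0 e : 0 <= base e.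
  by case: e => [[v j]|u] //=; case: ifP => // /negbT/len0.
have wE e : weight len eps e = base e + eps by case: e => [[v j]|u] //=; rewrite add0r.
apply: (@le_trans _ _ (\sum_e (base e * `|anti A e - anti B e| + eps))).
  apply: ler_sum => e _; rewrite wE mulrDl lerD ?ler_wpM2l// ler_piMr//.
  exact: le_trans (tE e) (aE e).
rewrite big_split /= sumr_const mulr_natr lerD2r.
rewrite big_sumType /= [X in _ + X]big1 ?addr0; last by move=> i _; rewrite mul0r.
rewrite (eq_bigr (fun p : X * 'I_N => (if p.1 == rho then 0 else len p.1 (par p.1)) *
   `|(#|A :&: T p.1| <= p.2)%N%:R - (#|B :&: T p.1| <= p.2)%N%:R|)); last by case.
rewrite -(pair_bigA _ (fun v (j : 'I_N) => (if v == rho then 0 else len v (par v)) *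
   `|(#|A :&: T v| <= j)%N%:R - (#|B :&: T v| <= j)%N%:R|)) /=.
rewrite /cut_dist [leRHS]big_mkcond; apply: ler_sum => v _ /=.
rewrite -mulr_sumr; case: eqP => [_|/eqP vr] /=; first by rewrite mul0r.
by rewrite ler_wpM2l ?len0// !mass_in_set sum_dist_le.
Qed.

(** The factor 2 bounds the rescaling [(1 - 2 * delta)^-1]. *)
Lemma cut_le_moves len eps x x' : 0 <= eps -> (forall v, v != rho -> 0 <= len v (par v)) ->
  admissible x -> admissible x' ->
  cut_dist rho par len (mass_of x) (mass_of x') <=
    2 * \sum_e weight len eps e * `|x' e - x e|.
Proof.
move=> eps0 len0 I I'.
have w0 e : 0 <= weight len eps e.
  case: e => [[v j]|u] //=; rewrite addr_ge0//; case: ifP => // /negbT; exact: len0.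
rewrite big_sumType /=.
apply: (@le_trans _ _ (2 * \sum_(p : X * 'I_N) weight len eps (inl p) * `|x' (inl p) - x (inl p)|)).
  rewrite (eq_bigr (fun p : X * 'I_N => weight len eps (inl (p.1, p.2)) *
     `|x' (inl (p.1, p.2)) - x (inl (p.1, p.2))|)); last by case.
  rewrite -(pair_bigA _ (fun v (j : 'I_N) => weight len eps (inl (v, j)) *
     `|x' (inl (v, j)) - x (inl (v, j))|)) /= mulr_sumr /cut_dist big_mkcond.
  apply: ler_sum => v _ /=; have [->|vr] := eqVneq v rho => /=.
    by rewrite mulr_ge0// sumr_ge0// => j _; rewrite mulr_ge0// add0r.
  have lv := len0 v vr.
  rewrite -mulr_sumr mulrCA.
  apply: ler_pM => //; first by rewrite lerDl.
  rewrite !mass_in_of// -mulrBl normrM mulrC; apply: ler_pM => //.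
    by rewrite ger0_norm ?inv_denom_le2// invr_ge0 ltW ?denom_gt0.
  rewrite -sumrB big_mkcond /=; apply: le_trans (ler_norm_sum _ _ _) _.
  apply: ler_sum => j _; case: ifP => _; last by rewrite normr0.
  by rewrite opprB addrC addrA subrK.
rewrite mulrDr lerDl mulr_ge0// sumr_ge0// => u _.
by rewrite mulr_ge0.
Qed.

End profiles.

(** * The online algorithm *)

Section online.
Variables (R : realType) (X : finType) (e : rel X) (len : X -> X -> R).
Variables (rho : X) (par : X -> X) (dep : X -> nat) (D k : nat).
Hypothesis rooted : rooting rho par dep.
Hypothesis edgeE : forall x y,
  e x y = (y != rho) && (par y == x) || (x != rho) && (par x == y).
Hypothesis lenP : edge_lengths e len.
Hypothesis conn : forall x y, connect e x y.
Hypothesis depD : forall v, (dep v <= D)%N.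
Hypothesis k0 : (0 < k)%N.
Hypothesis kN : (k < #|X|)%N.
Local Notation d := (path_dist e len).
Local Notation cut := (cut_dist rho par len).
Local Notation E := (entry X).
Local Notation state_ok := (admissible rho par k).
Local Notation delta := (delta R k).
Local Notation tgt := (target R par k).
Local Notation alpha := (4 * D.+2%:R : R).

(* The summable perturbation keeps the regularizer strictly convex on edges
   of length zero and on the entries of single points. *)
Let eps (t : nat) : R := 2^-1 ^+ t.
Let w t : E -> R := weight rho par len (eps t).

Let eps_gt0 t : 0 < eps t. Proof. by rewrite exprn_gt0// invr_gt0. Qed.

Let len_ge0 v : v != rho -> 0 <= len v (par v).
Proof. exact: parent_len_ge0 edgeE lenP v. Qed.

Let w_gt0 t a : 0 < w t a.
Proof.
case: a => [[v j]|u] /=; last exact: eps_gt0.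
by rewrite ltr_wpDl//; case: ifP => // /negbT; exact: len_ge0.
Qed.

Let w_decr t a : w t.+1 a <= w t a.
Proof.
have h : eps t.+1 <= eps t.
  by rewrite /eps exprS ler_piMl ?(ltW (eps_gt0 t))// invf_le1// ler1n.
by case: a => [[v j]|u] //=; rewrite lerD2l.
Qed.

Let sum_eps T : \sum_(t < T) eps t <= 2.
Proof.
suff : \sum_(t < T) eps t = 2 - 2 * eps T by move=> ->; have := eps_gt0 T; lra.
elim: T => [|T IH]; first by rewrite big_ord0 /eps expr0; ring.
rewrite big_ord_recr /= IH /eps exprS; set z := _ ^+ T; lra.
Qed.

(** The admissibility premise sits under the existential so that choice yields a total function of
    time, profile and request. *)
Let next_ex (p : nat * (E -> R) * X) : exists x', state_ok p.1.2 ->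
  state_ok x' /\ exists la mu f, projection rho par k (w p.1.1) p.1.2 p.2 x' la mu f.
Proof.
case: p => [[t x] r] /=.
have [I|nI] := pselect (state_ok x); last by exists x.
have [x' [la [mu [f P]]]] := projection_exists rooted r k0 (w_gt0 t) (inv_gt0 I).
exists x' => _; split; last by exists la, mu, f.
exact: (projection_invariant rooted (w_gt0 t) I P).
Qed.

Let next := projT1 (choice next_ex).
Let nextP p := projT2 (choice next_ex) p.

Let state (s : seq X) : nat * (E -> R) :=
  foldl (fun p r => (p.1.+1, next (p, r))) (0%N, initial R rho k) s.

Let state_rcons s r : state (rcons s r) = ((state s).1.+1, next (state s, r)).
Proof. by rewrite /state foldl_rcons. Qed.

Let state_time s : (state s).1 = size s.
Proof. by elim/last_ind: s => // s r IH; rewrite state_rcons size_rcons IH. Qed.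

Let state_inv s : state_ok (state s).2.
Proof.
elim/last_ind: s => [|s r IH]; first exact: (initial_invariant R rooted k0 kN).
by rewrite state_rcons; have [] := @nextP (state s, r) IH.
Qed.

Let state_proj s r : exists la mu f,
  projection rho par k (w (size s)) (state s).2 r (state (rcons s r)).2 la mu f.
Proof.
have [_] := @nextP (state s, r) (state_inv s).
by rewrite state_rcons -state_time.
Qed.

Let alg (s : seq X) : X -> R := mass_of k (state s).2.

Let alg_online : online_fractional k alg.
Proof.
split=> [s x|s|s x].
- exact: (mass_of_ge0 k0 _ (state_inv s)).
- exact: (mass_of_total rooted k0 kN (state_inv s)).
- have [la [mu [f P]]] := state_proj s x.
  exact: (mass_of_request k0 (state_inv _) P).
Qed.

Let earthmover_alg s r : earthmover d (alg s) (alg (rcons s r)) <=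
  2 * \sum_a w (size s) a * `|(state (rcons s r)).2 a - (state s).2 a|.
Proof.
have [ge0 tot _] := alg_online.
apply: le_trans (earthmover_le_cut rooted edgeE lenP conn _ _ _) _ => //.
  by rewrite !tot.
exact: (cut_le_moves rooted k0 (ltW (eps_gt0 _)) len_ge0 (state_inv _) (state_inv _)).
Qed.

Let kappa a : R := 2 * D.+2%:R + 2 * height R dep D a + 1.

Let kappa_ge0 a : 0 <= kappa a.
Proof. by rewrite addr_ge0// addr_ge0// mulr_ge0//; case: a => [[v j]|u] /=. Qed.

(** The part of the relative entropy that depends on [x], plus a linear term whose decrease is the
    second sum of [projection_cost]. Since [x a <= 1], all terms are nonnegative. *)
Let potential t (A : {set X}) (x : E -> R) : R :=
  alpha * (\sum_a w t a * tgt A a * - ln (x a)) + \sum_a kappa a * (w t a * x a).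

Let L : R := ln (2 * k.+1%:R).

Let deltaV : delta^-1 = 2 * k.+1%:R.
Proof. by rewrite invrK natr1. Qed.

Let nln_ge0 (x : E -> R) a : state_ok x -> 0 <= - ln (x a).
Proof. by move=> I; rewrite oppr_ge0 ln_le0// (inv_le1 I). Qed.

Let nln_le (x : E -> R) a : state_ok x -> - ln (x a) <= L.
Proof.
move=> I; have xd : delta <= x a.
  case: a => [p|u]; first exact: inv_slot I p.
  apply: le_trans (inv_own I u); have := delta_gt0 R k; lra.
rewrite /L -deltaV lnV ?posrE ?delta_gt0// lerN2 ler_ln ?posrE ?delta_gt0//.
exact: lt_le_trans (delta_gt0 _ _) xd.
Qed.

Let L_ge0 : 0 <= L.
Proof. by rewrite ln_ge0// -natrM ler1n. Qed.

Let step s r (A B : {set X}) : #|B| = k -> r \in B ->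
  \sum_a w (size s) a * `|(state (rcons s r)).2 a - (state s).2 a|
    + potential (size s).+1 B (state (rcons s r)).2 <=
  potential (size s) A (state s).2
    + alpha * L * (cut (set_mass R A) (set_mass R B) + eps (size s) * #|E|%:R).
Proof.
move=> Bk rB; have [la [mu [f P]]] := state_proj s r.
have I := state_inv s; have I' := state_inv (rcons s r).
set x := (state s).2 in P I *; set x' := (state _).2 in P I' *; set t := size s in P *.
have d0 := delta_gt0 R k.
have tg0 a : 0 <= tgt B a by apply: le_trans (ltW d0) _; exact: target_ge.
have al0 : 0 <= alpha by rewrite mulr_ge0.
have := projection_cost rooted (w_gt0 t) I P depD (target_profile R rooted k B)
  tg0 (fun p => target_floor R rho par p Bk) (target_served R par k rB).
have move_bound := target_move k0 kN A B (ltW (eps_gt0 t)) len_ge0.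
(* The weights decrease in time and all their coefficients are nonnegative, so changing the
   regularizer is free. *)
have nextpot : potential t.+1 B x' <= potential t B x'.
  apply: lerD.
    apply: (ler_wpM2l al0); apply: ler_sum => a _.
    by rewrite ler_wpM2r ?nln_ge0// ler_wpM2r.
  apply: ler_sum => a _; rewrite ler_wpM2l ?kappa_ge0// ler_wpM2r//.
  exact: ltW (inv_gt0 I' a).
(* As [delta <= x a <= 1], each unit of change in the offline profile costs at most
   [L = ln (1 / delta)]. *)
have shift : \sum_a w t a * tgt B a * - ln (x a) <=
    \sum_a w t a * tgt A a * - ln (x a)
    + L * \sum_a w t a * `|tgt A a - tgt B a|.
  rewrite mulr_sumr -big_split; apply: ler_sum => a _ /=.
  rewrite mulrCA -[w t a * tgt B a * _]mulrA -[w t a * tgt A a * _]mulrA -mulrDr.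
  rewrite ler_pM2l//.
  have : (tgt B a - tgt A a) * - ln (x a) <= `|tgt A a - tgt B a| * L.
    rewrite distrC; apply: le_trans (ler_wpM2r (nln_ge0 a I) (ler_norm _)) _.
    by rewrite ler_wpM2l// nln_le.
  lra.
have shift' : L * \sum_a w t a * `|tgt A a - tgt B a| <=
    L * (cut (set_mass R A) (set_mass R B) + eps t * #|E|%:R).
  exact: (ler_wpM2l L_ge0 move_bound).
have := ler_wpM2l al0 (le_trans shift (lerD (lexx _) shift')).
have -> : \sum_a w t a * tgt B a * (ln (x' a) - ln (x a)) =
   \sum_a w t a * tgt B a * - ln (x a) - \sum_a w t a * tgt B a * - ln (x' a).
  by rewrite -sumrB; apply: eq_bigr => a _; rewrite -mulrBr opprK addrC.
have -> : \sum_a (2 * D.+2%:R + 2 * height R dep D a + 1) * (w t a * (x a - x' a)) =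
    \sum_a kappa a * (w t a * x a) - \sum_a kappa a * (w t a * x' a).
  by rewrite -sumrB; apply: eq_bigr => a _; rewrite -mulrBr -mulrBr.
move: nextpot; rewrite /potential; lra.
Qed.

Let const : R := alpha * (\sum_a w 0 a * L) + \sum_a kappa a * w 0 a.

Let start A : potential 0 A (initial R rho k) <= const.
Proof.
have I := initial_invariant R rooted k0 kN.
apply: lerD.
  rewrite ler_wpM2l ?mulr_ge0//; apply: ler_sum => a _; rewrite -mulrA ler_pM2l//.
  apply: le_trans (nln_le a I); rewrite ler_piMl ?nln_ge0//; exact: target_le1.
apply: ler_sum => a _; rewrite ler_wpM2l ?kappa_ge0// ler_piMr ?(ltW (w_gt0 _ _))//.
exact: (inv_le1 I a).
Qed.

Let potential_ge0 t A (x : E -> R) : state_ok x -> 0 <= potential t A x.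
Proof.
move=> I; have w0 b := ltW (w_gt0 t b).
rewrite addr_ge0//.
  rewrite mulr_ge0 ?mulr_ge0// sumr_ge0// => a _; rewrite mulr_ge0 ?nln_ge0// mulr_ge0//.
  by apply: le_trans (ltW (delta_gt0 R k)) _; exact: target_ge.
by apply: sumr_ge0 => a _; rewrite !mulr_ge0 ?kappa_ge0// ltW ?(inv_gt0 I).
Qed.

Let total (s : seq X) (A : nat -> {set X}) : offline_solution k s A ->
  online_cost d alg s <= 2 * (alpha * L) * movement_cost d (size s) (fun t => set_mass R (A t))
    + 2 * (const + alpha * L * (2 * #|E|%:R)).
Proof.
move=> [Ak As].
pose x t := (state (take t s)).2.
pose mv t := \sum_a w t a * `|x t.+1 a - x t a|.
have rq t : (t < size s)%N -> exists2 r, take t.+1 s = rcons (take t s) r & r \in A t.+1.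
  move=> ts; exists (tnth (in_tuple s) (Ordinal ts)); last exact: As (Ordinal ts).
  set r := tnth _ _; rewrite (take_nth r)//.
  by rewrite /r [in RHS](tnth_nth r).
have szt t : (t < size s)%N -> size (take t s) = t by move=> ts; rewrite size_take ts.
have al0 : 0 <= alpha * L by rewrite mulr_ge0// mulr_ge0.
have cutA t : cut (set_mass R (A t)) (set_mass R (A t.+1)) <=
    earthmover d (set_mass R (A t)) (set_mass R (A t.+1)).
  apply: (cut_le_earthmover rooted edgeE lenP conn) => //.
  have tot u : \sum_z set_mass R (A u) z = k%:R.
    by rewrite /set_mass -natr_sum -(Ak u) -sum1_card [in RHS]big_mkcond.
  by rewrite !tot.
pose mc T := movement_cost d T (fun t => set_mass R (A t)).
have main T : (T <= size s)%N -> \sum_(t < T) mv t + potential T (A T) (x T) <=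
    const + alpha * L * (movement_cost d T (fun t => set_mass R (A t))
      + \sum_(t < T) eps t * #|E|%:R).
  elim: T => [|T IH] Ts.
    rewrite !big_ord0 /mc /movement_cost big_ord0 addr0 mulr0 addr0 add0r.
    by rewrite /x take0; exact: start.
  have [r rE rA] := rq T Ts.
  have := @step (take T s) r (A T) (A T.+1) (Ak _) rA.
  rewrite (szt T Ts) -rE => st.
  have mcS : mc T.+1 = mc T + earthmover d (set_mass R (A T)) (set_mass R (A T.+1)).
    by rewrite /mc /movement_cost big_ord_recr.
  rewrite -/(mc T.+1) mcS !big_ord_recr /=.
  have := IH (ltnW Ts); rewrite -/(mc T).
  have := ler_wpM2l al0 (cutA T).
  move: st; rewrite -/(x T) -/(x T.+1) -/(mv T).
  lra.
have := main (size s) (leqnn _).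
have := potential_ge0 (size s) (A (size s)) (state_inv (take (size s) s)).
rewrite -mulr_suml.
have : alpha * L * ((\sum_(t < size s) eps t) * #|E|%:R) <= alpha * L * (2 * #|E|%:R).
  by rewrite ler_wpM2l// ler_wpM2r.
have : online_cost d alg s <= \sum_(t < size s) 2 * mv t.
  apply: ler_sum => t _; have [r rE _] := rq t (ltn_ord t).
  have := earthmover_alg (take t s) r.
  by rewrite -rE szt.
rewrite -mulr_sumr -/(x (size s)) -/(mc (size s)).
lra.
Qed.

Let full_set (x : X) : exists B : {set X}, #|B| = k /\ x \in B.
Proof.
pose s := take k (x :: rem x (enum X)).
have us : uniq (x :: rem x (enum X)).
  by rewrite /= mem_rem_uniq ?enum_uniq// inE eqxx rem_uniq ?enum_uniq.
have sz : size (x :: rem x (enum X)) = #|X|.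
  rewrite /= size_rem ?mem_enum// -cardE prednK//; exact: ltn_trans k0 kN.
exists [set z in s]; split; last by rewrite finset.inE /s -(prednK k0) /= mem_head.
rewrite cardsE (card_uniqP _) ?take_uniq//.
by rewrite size_take sz kN.
Qed.

(** Guarantees that [opt_cost] is an infimum over a nonempty set, so that a bound against every
    offline solution passes to it. *)
Let offline_ex (s : seq X) : exists A, offline_solution k s A.
Proof.
have [B BP] := choice full_set.
exists (fun t => B (nth rho s t.-1)); split=> [t|i]; first by case: (BP (nth rho s t.-1)).
by rewrite (tnth_nth rho) /=; case: (BP (nth rho s i)).
Qed.

Lemma competitive_algorithm (C : R) : 0 < C -> 2 * (4 * D.+2%:R * ln (2 * k.+1%:R)) <= C ->
  exists alg0 : seq X -> X -> R, online_fractional k alg0 /\ competitive d k alg0 C.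
Proof.
move=> C0 LC; exists alg; split=> //.
exists (2 * (const + alpha * L * (2 * #|E|%:R))) => s.
rewrite -lerBlDr [C * _]mulrC -ler_pdivrMr//; apply: lb_le_inf.
  have [A AP] := offline_ex s.
  by exists (movement_cost d (size s) (fun t => set_mass R (A t))), A.
move=> c [A [AP ->]].
rewrite ler_pdivrMr// lerBlDr [_ * C]mulrC; apply: le_trans (total AP) _.
rewrite lerD2r ler_wpM2r//.
apply: sumr_ge0 => t _; apply: lb_le_inf; last first.
  by move=> c' [f [fp ->]]; exact: (plan_cost_ge0 (path_dist_ge0 lenP conn) fp).
have tot u : \sum_z set_mass R (A u) z = k%:R.
  by case: AP => Ak _; rewrite /set_mass -natr_sum -(Ak u) -sum1_card [in RHS]big_mkcond.
have [f fp _] := flow_plan rooted edgeE lenP conn (u := set_mass R (A t))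
  (v := set_mass R (A t.+1)) (fun=> ler0n _ _) (fun=> ler0n _ _) (etrans (tot t) (esym (tot t.+1))).
by exists (plan_cost d f), f.
Qed.

End online.

Theorem mainTheorem1 (R : realType) :
  exists C : R,
    forall (X : finType) (e : rel X) (len : X -> X -> R) (k : nat),
      is_tree e -> edge_lengths e len ->
      (0 < k)%N -> (k < #|X|)%N ->
      exists alg : seq X -> X -> R,
        online_fractional k alg /\
        competitive (path_dist e len) k alg
          (C * (hop_diameter e)%:R * ln (k.+1)%:R).
Proof.
(* [2 * 4 * (D + 2) * ln (2 * (k + 1))] is at most [8 * (3 * D) * (2 * ln (k + 1))], because
   [1 <= D] and [2 <= k + 1]. *)
exists 48 => X e len k tree lenP k0 kN.
have /card_gt0P[rho _] : (0 < #|X|)%N by exact: ltn_trans k0 kN.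
have [par [dep [rooted edgeE depD]]] := tree_rooting rho tree.
have conn : forall x y, connect e x y by case: tree.
set D := hop_diameter e in depD *.
have D1 : 1 <= D%:R :> R.
  rewrite ler1n; have : (1 < #|X|)%N by exact: leq_ltn_trans k0 kN.
  rewrite -cardsT => /card_gt1P[x [y [_ _ xy]]].
  have [v vr] : exists v, v != rho.
    have [xr|xr] := eqVneq x rho; last by exists x.
    by exists y; rewrite -xr eq_sym.
  by apply: leq_trans (depD v); apply: leq_ltn_trans (proj2 rooted v vr).
have k2 : 2 <= k.+1%:R :> R by rewrite ler_nat ltnS.
have lk : 0 < ln k.+1%:R :> R by rewrite ln_gt0//; lra.
have l2 : ln (2 * k.+1%:R) <= 2 * ln k.+1%:R :> R.
  rewrite lnM ?posrE//.
  have : ln 2 <= ln k.+1%:R :> R by rewrite ler_ln ?posrE.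
  lra.
apply: (competitive_algorithm rooted edgeE lenP conn depD k0 kN).
  by rewrite !mulr_gt0//; lra.
have DE : D.+2%:R = D%:R + 2 :> R by rewrite -addn2 natrD.
rewrite DE.
have : (D%:R + 2) * ln (2 * k.+1%:R) <= (3 * D%:R) * (2 * ln k.+1%:R) :> R.
  apply: ler_pM => //; [lra | | lra].
  by rewrite ln_ge0//; lra.
lra.
Qed.
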